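(* Let $\mathcal X=\mathcal Y=\mathbb S^d$ and assume that $\nu$ satisfies $\mathrm{TI}(\tau)$ for some $\tau\in(0,\infty)$. (i) When the cost is $c(x,y)=1-\langle x,y\rangle$, for every $\varepsilon>0$ Sinkhorn's algorithm converges exponentially fast, and for $\varepsilon\le\tau+\sqrt{\tau+\tau^2}$ it converges with rate $$1-\frac{\varepsilon^2}{\varepsilon^2+2\tau\varepsilon+\tau}.$$ (ii) When the cost is $c_\delta(x,y)=\arccos(\delta\langle x,y\rangle)^2$ with $\delta\in(0,1)$ fixed, for every $\varepsilon>0$ Sinkhorn's algorithm converges exponentially fast, and for $$\varepsilon\le\tau\Big(\delta^2+\frac{2\pi}{\sqrt{1-\delta^2}}\Big)+\sqrt{\tau^2\Big(\delta^2+\frac{2\pi}{\sqrt{1-\delta^2}}\Big)^2+\frac{4\pi^2\tau}{1-\delta^2}}$$ it converges with rate $$1-\frac{\varepsilon^2}{\varepsilon^2+2\tau\varepsilon\big(\delta^2+\frac{2\pi}{\sqrt{1-\delta^2}}\big)+\frac{4\pi^2\tau}{1-\delta^2}}.$$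
   Context: $\mathbb S^d\subseteq\mathbb R^{d+1}$ is the $d$-dimensional Riemannian sphere with the angular metric and distance $\mathsf d(x,y)=\arccos(\langle x,y\rangle)$. $\rho,\nu\in\mathcal P(\mathbb S^d)$, $\varepsilon>0$. $\mathscr H(p|q)=\int\log\frac{dp}{dq}dp$ ($+\infty$ if $p\not\ll q$). $\mathrm{TI}(\tau)$ for $\nu$ means $\mathbf W_2^2(\mu,\nu)\le2\tau\mathscr H(\mu|\nu)$ for all $\mu\in\mathcal P(\mathbb S^d)$, where $\mathbf W_2^2(\mu,\nu)=\inf_{\pi\in\Pi(\mu,\nu)}\int\mathsf d^2d\pi$ and $\Pi$ denotes couplings. For a cost $c$ (either of the two), $\pi^\nu_\varepsilon$ is the unique minimizer of $\inf_{\pi\in\Pi(\rho,\nu)}\int c\,d\pi+\varepsilon\mathscr H(\pi|\rho\otimes\nu)$. Sinkhorn's algorithm: starting from $\varphi^0_\varepsilon$ (typically $0$), for $n\ge0$, $\psi^n_\varepsilon(y)=\varepsilon\log\int e^{-(c(x,y)+\varphi^n_\varepsilon(x))/\varepsilon}\rho(dx)$ and $\varphi^{n+1}_\varepsilon(x)=\varepsilon\log\int e^{-(c(x,y)+\psi^n_\varepsilon(y))/\varepsilon}\nu(dy)$; $\pi^{n,n}$ has $\rho\otimes\nu$-density $e^{-(c+\varphi^n_\varepsilon(x)+\psi^n_\varepsilon(y))/\varepsilon}$. The initialization is assumed smooth enough that differentiation under the integral sign is justified along the iterates. For given $\varepsilon$: ''Sinkhorn's algorithm converges exponentially fast'' means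 there is $\kappa'\in(0,1)$ such that for all $n\ge1$, $\mathscr H(\pi^\nu_\varepsilon|\pi^{n+1,n+1})\le(1-\kappa')^n\mathscr H(\pi^\nu_\varepsilon|\pi^{0,0})$; ''with rate $1-\kappa$'' means this holds for all $n\ge1$ with $\kappa'=\kappa$. *)

(* Defs.v *)
From HB Require Import structures.
From mathcomp Require Import all_boot all_order all_algebra.
From mathcomp Require Import all_classical all_reals all_analysis.

Set Implicit Arguments.
Unset Strict Implicit.
Unset Printing Implicit Defensive.

Import Order.TTheory GRing.Theory Num.Theory.
Import numFieldTopology.Exports numFieldNormedType.Exports.

Local Open Scope classical_set_scope.
Local Open Scope ring_scope.

Definition dotp (R : realType) (n : nat) (x y : 'rV[R]_n) : R :=
  \sum_(i < n) x ord0 i * y ord0 i.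

Definition unit_sphere (R : realType) (d : nat) : set 'rV[R]_d.+1 :=
  [set x | dotp x x = 1].

(* The sphere S^d of R^(d+1) as a type, with the topology induced by the
   ambient space and the corresponding Borel sigma-algebra. *)
Definition sphere (R : realType) (d : nat) : Type :=
  set_type (@unit_sphere R d).

HB.instance Definition _ (R : realType) (d : nat) :=
  Topological.copy (sphere R d) (set_type (@unit_sphere R d)).

Lemma delta_mx_unit_sphere (R : realType) (d : nat) :
  delta_mx ord0 ord0 \in @unit_sphere R d.
Proof.
apply/mem_set; rewrite /unit_sphere/= /dotp big_ord_recl /= !mxE !eqxx mulr1.
by rewrite big1 ?addr0// => i _; rewrite mxE eqxx/= mulr0.
Qed.

HB.instance Definition _ (R : realType) (d : nat) :=
  isPointed.Build (sphere R d)
    (exist _ (delta_mx ord0 ord0) (delta_mx_unit_sphere R d)).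

HB.instance Definition _ (R : realType) (d : nat) :=
  Measurable.copy (sphere R d) (g_sigma_algebraType (@open (sphere R d))).

Definition sdot (R : realType) (d : nat) (x y : sphere R d) : R :=
  dotp (set_val x) (set_val y).

Definition sdist (R : realType) (d : nat) (x y : sphere R d) : R :=
  acos (sdot x y).

(* On p-null sets the Radon-Nikodym derivative may vanish; the value of lne
   there is irrelevant since the integral is taken with respect to p. *)
Definition entropy (d : measure_display) (T : measurableType d) (R : realType)
    (p q : probability T R) : \bar R :=
  if `[< p `<< q >]
  then (\int[p]_x lne (Radon_Nikodym (charge_of_finite_measure p) q x))%E
  else +oo%E.

Section couplings.
Context (d1 d2 : measure_display) (T1 : measurableType d1)
  (T2 : measurableType d2) (R : realType).
Implicit Types (rho : probability T1 R) (nu : probability T2 R).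
Implicit Types (c : T1 -> T2 -> R) (eps : R).

Definition coupling rho nu : set (probability (T1 * T2)%type R) :=
  [set gamma | (forall A, measurable A -> gamma (A `*` setT) = rho A) /\
               (forall B, measurable B -> gamma (setT `*` B) = nu B)].

Definition eot_cost c eps rho nu (gamma : probability (T1 * T2)%type R)
    : \bar R :=
  (\int[gamma]_z (c z.1 z.2)%:E + eps%:E * entropy gamma (rho \x nu))%E.

(* Uniqueness is not part of the definition: it is a consequence of the strict
   convexity of the entropy. *)
Definition eot_plan c eps rho nu (gamma : probability (T1 * T2)%type R) : Prop :=
  coupling rho nu gamma /\
  forall gamma', coupling rho nu gamma' ->
    (eot_cost c eps rho nu gamma <= eot_cost c eps rho nu gamma')%E.

Definition sinkhorn_psi c eps rho (phi : T1 -> R) : T2 -> R :=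
  fun y => eps * ln (\int[rho]_x expR (- (c x y + phi x) / eps)).

Definition sinkhorn_phi_next c eps nu (psi : T2 -> R) : T1 -> R :=
  fun x => eps * ln (\int[nu]_y expR (- (c x y + psi y) / eps)).

Fixpoint sinkhorn_phi c eps rho nu (phi0 : T1 -> R) (n : nat) : T1 -> R :=
  if n is m.+1 then
    sinkhorn_phi_next c eps nu
      (sinkhorn_psi c eps rho (sinkhorn_phi c eps rho nu phi0 m))
  else phi0.

Definition sinkhorn_density c eps rho nu (phi0 : T1 -> R) (n : nat)
    (z : T1 * T2) : R :=
  let phi := sinkhorn_phi c eps rho nu phi0 n in
  let psi := sinkhorn_psi c eps rho phi in
  expR (- (c z.1 z.2 + phi z.1 + psi z.2) / eps).

(* [plan n] is the probability pi^{n,n}. *)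
Definition sinkhorn_plans c eps rho nu (phi0 : T1 -> R)
    (plan : nat -> probability (T1 * T2)%type R) : Prop :=
  forall n A, measurable A ->
    plan n A = (\int[rho \x nu]_(z in A)
                  (sinkhorn_density c eps rho nu phi0 n z)%:E)%E.

(* For a bounded cost with bounded derivatives in y, this is what is needed to
   differentiate y |-> \int exp(-(c x y + phi0 x) / eps) rho(dx) under the
   integral sign; all later iterates are then bounded. *)
Definition sinkhorn_init eps rho (phi0 : T1 -> R) : Prop :=
  measurable_fun setT phi0 /\
  rho.-integrable setT (fun x => (expR (- phi0 x / eps))%:E).

(* Both plans are uniquely determined by the other data. *)
Definition sinkhorn_rate c eps rho nu (phi0 : T1 -> R) (r : R) : Prop :=
  forall (gamma : probability (T1 * T2)%type R)
         (plan : nat -> probability (T1 * T2)%type R),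
    eot_plan c eps rho nu gamma -> sinkhorn_plans c eps rho nu phi0 plan ->
    forall n : nat, (1 <= n)%N ->
      (entropy gamma (plan n.+1) <= (r ^+ n)%:E * entropy gamma (plan 0%N))%E.

Definition sinkhorn_exp_cvg c eps rho nu (phi0 : T1 -> R) : Prop :=
  exists kappa : R, 0 < kappa < 1 /\
    sinkhorn_rate c eps rho nu phi0 (1 - kappa).

End couplings.

(* Square of the 2-Wasserstein distance for the angular distance. *)
Definition W2sq (R : realType) (d : nat) (mu nu : probability (sphere R d) R)
    : \bar R :=
  ereal_inf [set (\int[gamma]_z (sdist z.1 z.2 ^+ 2)%:E)%E
            | gamma in coupling mu nu].

Definition transport_inequality (R : realType) (d : nat)
    (nu : probability (sphere R d) R) (tau : R) : Prop :=
  forall mu : probability (sphere R d) R,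
    (W2sq mu nu <= (2 * tau)%:E * entropy mu nu)%E.

Definition cost_dot (R : realType) (d : nat) (x y : sphere R d) : R :=
  1 - sdot x y.

Definition cost_acos (R : realType) (d : nat) (delta : R) (x y : sphere R d)
    : R :=
  acos (delta * sdot x y) ^+ 2.

(* Main.v *)
From HB Require Import structures.
Require Import Defs.
From mathcomp Require Import all_boot all_order all_algebra.
From mathcomp Require Import all_classical all_reals all_analysis.
From mathcomp Require Import measurable_realfun ring lra.

Set Implicit Arguments.
Unset Strict Implicit.
Unset Printing Implicit Defensive.

Import Order.TTheory GRing.Theory Num.Theory.
Import numFieldTopology.Exports numFieldNormedType.Exports.

Local Open Scope classical_set_scope.
Local Open Scope ring_scope.

(** Write gamma for the optimal plan, H n for the entropy of gamma relative to
    pi^{n,n}, rho^n for the first marginal of pi^{n,n} and nu^n for the second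
    marginal of pi^{n+1,n}. The contraction of H comes from playing two
    estimates of the transport distance between nu^n and nu against each other.

    Upper bound on the distance. The log-density of pi^{n,n} with respect to
    rho \x nu is -(c + phi^n + psi^n) / eps, and gamma has marginals rho and nu,
    so that H n - H n.+1 = H(rho | rho^n) + H(nu | nu^n). The first term
    dominates H(nu^n | nu): the plans pi^{n+1,n} and pi^{n,n} have relative
    entropy H(rho | rho^n) and second marginals nu^n and nu, and entropy
    decreases under projection ([marginal_entropy_le]). By the transport
    inequality, W2^2(nu^n, nu) <= 2 tau (H n - H n.+1).

    Lower bound on the distance. The plan pi^{n+1,n+1} splits into nu and the
    Gibbs laws p^y(dx) = exp (-(c x y + phi^{n+1} x + psi^{n+1} y) / eps) rho(dx).
    Given a coupling alpha of nu^n and nu, draw (y', y) from alpha and then x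
    from p^y'; as pi^{n+1,n} has the same conditional laws and first marginal
    rho, the pair (x, y) is a coupling of rho and nu. Minimality of gamma and
    convexity of the entropy give that H n.+1 is at most the alpha-average of
    H(p^y' | p^y) ([stability]). Up to a constant, the log-densities of p^y' and
    p^y differ by (c x y - c x y') / eps, which is at most
    sqrt L2 * d(y, y') / eps in absolute value when the cost is Lipschitz in its
    second argument; Hoeffding's lemma then gives
    H(p^y' | p^y) <= L2 d(y, y')^2 / (2 eps^2) ([conditional_entropy_le]). So
    H n.+1 <= L2 / (2 eps^2) W2^2(nu^n, nu).

    Together, H n.+1 <= (tau L2 / eps^2) (H n - H n.+1), which is a contraction
    by the factor 1 - eps^2 / (eps^2 + tau L2) ([sinkhorn_rate_of_transport]).
    It is used from n = 1 on, where all the potentials are bounded; the passage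
    from 0 to 1 only needs H 1 <= H 0, which is why n + 1 steps yield the n-th
    power of the rate.

    On the sphere the squared Lipschitz constant is at most 1 for 1 - <x, y> and
    4 pi^2 / (1 - delta^2) for arccos (delta <x, y>)^2. Taking for L2 the larger
    numbers 2 eps + 1 and 2 eps M + 4 pi^2 / (1 - delta^2), where
    M = delta^2 + 2 pi / sqrt (1 - delta^2), produces the rates of the theorem. *)

(** * Entropy through densities *)

(** The positive and the negative part of a function are separately monotone, and
    by convention an integral whose two parts are both infinite is -oo. *)
Lemma le_integral_measurable (d : measure_display) (T : measurableType d)
    (R : realType) (p : {measure set T -> \bar R}) (f g : T -> \bar R) :
  measurable_fun setT f -> measurable_fun setT g ->
  (forall x, (f x <= g x)%E) -> (\int[p]_x f x <= \int[p]_x g x)%E.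
Proof.
move=> mf mg fg; rewrite integralE [leRHS]integralE leeB//.
- apply: ge0_le_integral => //; [exact: measurable_funepos..|].
  by move=> x _; apply: (@funepos_le _ _ setT) => [y _|]; rewrite ?inE.
- apply: ge0_le_integral => //; [exact: measurable_funeneg..|].
  by move=> x _; apply: (@funeneg_le _ _ setT) => [y _|]; rewrite ?inE.
Qed.

Lemma measurable_lne_EFin (d : measure_display) (T : measurableType d)
    (R : realType) (f : T -> R) :
  measurable_fun setT f -> measurable_fun setT (fun x => lne (f x)%:E).
Proof.
move=> mf /=; apply: measurable_fun_ifT => //.
  apply: measurable_fun_ler => //.
by apply/measurable_EFinP; exact: measurableT_comp.
Qed.

Section density.
Context (d : measure_display) (T : measurableType d) (R : realType).
Implicit Types m p q : probability T R.

(** Entropies are computed by comparing everything with one reference probability;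
    real-valued densities keep the computations out of the extended reals. *)
Definition has_density m (f : T -> R) p : Prop :=
  [/\ measurable_fun setT f, forall x, 0 <= f x &
      forall A, measurable A -> p A = (\int[m]_(x in A) (f x)%:E)%E].

Lemma has_density_dominates m f p : has_density m f p -> p `<< m.
Proof.
move=> [mf f0 pE]; apply/null_content_dominatesP => A mA mA0.
rewrite pE// null_set_integral//.
by apply: (measurable_funTS); exact/measurable_EFinP.
Qed.

Lemma has_density_unit m : has_density m (cst 1) m.
Proof. by split => // A mA; rewrite [RHS](integral_cst m mA 1%E) mul1e. Qed.

Lemma ge0_integral_density m f p (E : set T) (h : T -> \bar R) :
  has_density m f p -> measurable E -> measurable_fun setT h ->
  (forall x, (0 <= h x)%E) ->
  (\int[p]_(x in E) h x = \int[m]_(x in E) (h x * (f x)%:E))%E.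
Proof.
move=> pf mE mh h0; have pm := has_density_dominates pf.
case: (pf) => mf f0 pE.
set g := Radon_Nikodym_SigmaFinite.f p m.
have mg : measurable_fun setT g.
  exact: measurable_int (Radon_Nikodym_SigmaFinite.f_integrable pm).
rewrite -(Radon_Nikodym_SigmaFinite.change_of_variables pm h0 mE); last first.
  exact: measurable_funTS.
apply: ge0_ae_eq_integral => //.
- by apply: emeasurable_funM; exact: measurable_funTS.
- apply: emeasurable_funM; apply: measurable_funTS => //.
  exact/measurable_EFinP.
- by move=> x _; rewrite mule_ge0// Radon_Nikodym_SigmaFinite.f_ge0.
- by move=> x _; rewrite mule_ge0// lee_fin.
apply: ae_eqe_mul2l; apply: integral_ae_eq => //.
- apply: (integrableS measurableT) => //.
  exact: Radon_Nikodym_SigmaFinite.f_integrable.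
- by apply: measurable_funTS; exact/measurable_EFinP.
- move=> A _ mA; rewrite -Radon_Nikodym_SigmaFinite.f_integral//; exact: pE.
Qed.

Lemma integral_density m f p (h : T -> \bar R) :
  has_density m f p -> measurable_fun setT h ->
  (\int[p]_x h x = \int[m]_x (h x * (f x)%:E))%E.
Proof.
move=> pf mh; have [mf f0 pE] := pf.
rewrite integralE [RHS]integralE !(ge0_integral_density pf)//;
  [|exact: measurable_funeneg|exact: measurable_funepos].
congr (_ - _)%E; apply: eq_integral => x _.
- by rewrite !funeposE maxe_pMl ?lee_fin// mul0e.
- by rewrite !funenegE maxe_pMl ?lee_fin// mul0e mulNe.
Qed.

Lemma density_of_dominated m p : p `<< m -> exists f, has_density m f p.
Proof.
move=> pm; set g := Radon_Nikodym_SigmaFinite.f p m.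
have gfin x : g x \is a fin_num by exact: Radon_Nikodym_SigmaFinite.f_fin_num.
have mg : measurable_fun setT g.
  exact: measurable_int (Radon_Nikodym_SigmaFinite.f_integrable pm).
exists (fine \o g); split.
- exact: measurableT_comp.
- by move=> x; apply: fine_ge0; exact: Radon_Nikodym_SigmaFinite.f_ge0.
- move=> A mA; have -> := Radon_Nikodym_SigmaFinite.f_integral pm mA.
  by apply: eq_integral => x _ /=; rewrite fineK.
Qed.

(** The quotient of the densities of p and q with respect to m is a version of the
    Radon-Nikodym derivative of p with respect to q. At a zero of f the
    integrand is lne 0 = -oo, on a set of p-measure 0. *)
Lemma entropy_density m p q f k :
  has_density m f p -> has_density m k q -> (forall x, 0 < k x) ->
  entropy p q = (\int[p]_x lne (f x / k x)%:E)%E.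
Proof.
move=> pf qk k0; have [mf f0 pE] := pf; have [mk _ qE] := qk.
have mfk : measurable_fun setT (fun x => f x / k x).
  apply: measurable_funM => //.
  have -> : (fun x => (k x)^-1) = (fun x => expR (- ln (k x))).
    by apply/funext => x; rewrite expRN lnK// posrE.
  apply: measurableT_comp => //; apply: measurable_funN.
  exact: measurableT_comp.
have fk0 x : 0 <= f x / k x by rewrite divr_ge0// ltW.
have pfk A : measurable A -> p A = (\int[q]_(x in A) (f x / k x)%:E)%E.
  move=> mA; rewrite (ge0_integral_density qk)//; last first.
    exact/measurable_EFinP.
  rewrite pE//; apply: eq_integral => x _.
  by rewrite -EFinM divfK// gt_eqF.
have pq : p `<< q by apply: (@has_density_dominates q (fun x => f x / k x)).
rewrite /entropy asboolT//.
set g := Radon_Nikodym _ _.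
have gE : ae_eq q setT g (fun x => (f x / k x)%:E).
  apply: integral_ae_eq => //.
  - exact: Radon_Nikodym_integrable.
  - exact/measurable_EFinP.
  - move=> E _ mE; rewrite -Radon_Nikodym_integral//; exact: pfk.
have mlne : measurable_fun setT (fun x => lne (g x)).
  have -> : (fun x => lne (g x)) = (fun x => lne (fine (g x))%:E).
    apply/funext => x; rewrite fineK//; exact: Radon_Nikodym_fin_num.
  apply: measurable_lne_EFin; apply: measurableT_comp => //.
  by apply: (measurable_int q); exact: Radon_Nikodym_integrable.
apply: ae_eq_integral => //; first exact: measurable_lne_EFin.
have /(null_dominates_ae_eq measurableT pq) := gE.
by apply: filterS => x /= + _ => ->.
Qed.

Lemma exists_density m (f : T -> R) :
  measurable_fun setT f -> (forall x, 0 <= f x) ->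
  (\int[m]_x (f x)%:E = 1)%E -> exists p, has_density m f p.
Proof.
move=> mf f0 f1; have intf : m.-integrable setT (EFin \o f).
  apply/integrableP; split; first exact/measurable_EFinP.
  under eq_integral do rewrite /= ger0_norm//.
  by rewrite f1 ltry.
have pos A : (0 <= induced_charge intf A)%E.
  by apply: integral_ge0 => x _; rewrite lee_fin.
pose mu := @measure_of_charge _ _ _ _ pos.
have mu1 : mu setT = 1%E by exact: f1.
pose P : probability T R := HB.pack mu (Measure_isProbability.Build _ _ _ mu mu1).
by exists P.
Qed.

End density.

Lemma integral_law (d d' : measure_display) (T : measurableType d)
    (T' : measurableType d') (R : realType) (p : probability T R)
    (q : probability T' R) (X : T -> T') (h : T' -> \bar R) :
  measurable_fun setT X -> measurable_fun setT h ->
  (forall A, measurable A -> p (X @^-1` A) = q A) ->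
  (\int[p]_x h (X x) = \int[q]_y h y)%E.
Proof.
move=> mX mh pXq.
have ge0 (g : T' -> \bar R) : measurable_fun setT g -> (forall y, 0 <= g y)%E ->
    (\int[p]_x g (X x) = \int[q]_y g y)%E.
  move=> mg g0; rewrite -[LHS](@ge0_integral_pushforward _ _ _ _ _ X mX p setT)//.
  by apply: eq_measure_integral => A mA _; exact: pXq.
rewrite integralE [RHS]integralE; congr (_ - _)%E.
- rewrite -(ge0 h^\+)%E//; last exact: measurable_funepos.
  by apply: eq_integral => x _; rewrite !funeposE.
- rewrite -(ge0 h^\-)%E//; last exact: measurable_funeneg.
  by apply: eq_integral => x _; rewrite !funenegE.
Qed.

(** * Scalar inequalities *)

Lemma ln_le_subr1 (R : realType) (x : R) : 0 < x -> ln x <= x - 1.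
Proof.
move=> x0; have := @expR_ge1Dx R (ln x).
by rewrite lnK ?posrE// -lerBrDl.
Qed.

Lemma ge0_derivable_ge (R : realType) (f df : R -> R) :
  (forall x : R, is_derive x 1 f (df x)) -> (forall x, 0 <= x -> 0 <= df x) ->
  forall x, 0 <= x -> f 0 <= f x.
Proof.
move=> fdf df0 x; rewrite le_eqVlt => /predU1P[<-//|x0].
have cf : {within `[0, x], continuous f}.
  by apply: derivable_within_continuous => y _; exact: ex_derive.
have [c /[!in_itv]/= /andP[c0 _]] := MVT x0 (fun y _ => fdf y) cf.
rewrite subr0 => fx.
by rewrite -subr_ge0 fx mulr_ge0// ?df0// ltW.
Qed.

Section hoeffding.
Context {R : realType}.
Implicit Types b u m z : R.

Let N u b := (1 + u) * expR b + (1 - u) * expR (- b).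
Let dN u b := (1 + u) * expR b - (1 - u) * expR (- b).

Let N_gt0 u b : -1 <= u <= 1 -> 0 < N u b.
Proof.
move=> /andP[u1 u2]; have := expR_gt0 b; have := expR_gt0 (- b).
rewrite /N; set x := expR _; set y := expR _ => x0 y0.
by have [?|?] := leP u 0; nra.
Qed.

Let is_derive_N u b : is_derive b 1 (N u) (dN u b).
Proof. by rewrite /N /dN; apply: is_derive_eq; rewrite /GRing.scale/=; ring. Qed.

Let is_derive_dN u b : is_derive b 1 (dN u) (N u b).
Proof. by rewrite /N /dN; apply: is_derive_eq; rewrite /GRing.scale/=; ring. Qed.

(** The left-hand side is (N u b) / 2, the exponential moment of the law on
    {-b, b} with mean u b. The logarithm of N u has derivative dN u / N u, whose
    derivative is 1 - (dN u / N u)^2 <= 1; integrating twice from 0 bounds it by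
    u b + b^2 / 2. *)
Lemma two_point_mgf_le u b : -1 <= u <= 1 -> 0 <= b ->
  (1 + u) / 2 * expR b + (1 - u) / 2 * expR (- b) <= expR (u * b + b ^+ 2 / 2).
Proof.
move=> u1 b0; have N0 x := N_gt0 x u1.
pose G x := u + x - dN u x / N u x.
pose F x := u * x + x ^+ 2 / 2 - ln (N u x / 2).
have NE : N u 0 = 2 by rewrite /N oppr0 expR0; ring.
have dNE : dN u 0 = 2 * u by rewrite /dN oppr0 expR0; ring.
have dG (x : R) : is_derive x 1 G ((dN u x / N u x) ^+ 2).
  have nz : N u x != 0 by rewrite gt_eqF.
  have ? := is_derive_N u x; have ? := is_derive_dN u x.
  have ? := is_deriveV nz.
  rewrite /G; apply: is_derive_eq.
  by rewrite /GRing.scale/=; field.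
have G0 x : 0 <= x -> 0 <= G x.
  move=> x0; have : G 0 <= G x.
    by apply: (ge0_derivable_ge dG) => // y _; rewrite sqr_ge0.
  rewrite {1}/G NE dNE; suff -> : u + 0 - 2 * u / 2 = 0 by [].
  by field.
have dF (x : R) : is_derive x 1 F (G x).
  have nz : N u x != 0 by rewrite gt_eqF.
  have ? := is_derive_N u x.
  have N20 : 0 < N u x / 2 by rewrite divr_gt0.
  have ? := is_derive1_ln N20.
  have ? : is_derive x 1 (fun x => N u x / 2) (dN u x / 2).
    by apply: is_derive_eq; rewrite /GRing.scale/=; field.
  have ? : is_derive x 1 (fun x => ln (N u x / 2))
      ((N u x / 2)^-1 * (dN u x / 2)).
    exact: (@is_derive1_comp _ (@ln R) (fun x => N u x / 2)).
  rewrite /F; apply: is_derive_eq.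
  by rewrite /G /GRing.scale/=; field.
have : F 0 <= F b by exact: (ge0_derivable_ge dF).
rewrite {1}/F NE divff// ln1 mulr0 expr0n/= mul0r addr0 subr0 subr_ge0.
rewrite -ler_expR lnK ?posrE ?divr_gt0// => /(le_trans _); apply.
by rewrite /N; lra.
Qed.

(** Hoeffding's lemma before integration. On [-b, b] the exponential lies below its
    chord; at m the chord is bounded by the two-point case, and s is its slope.
    Integrating against a law with mean m and support in [-b, b] kills the linear
    term and leaves the usual bound on the exponential moment. *)
Lemma hoeffding_tangent b m : 0 <= b -> `|m| <= b -> exists s : R,
  forall z, `|z| <= b -> expR z <= expR (m + b ^+ 2 / 2) + s * (z - m).
Proof.
move=> b0; have [->|bn0] := eqVneq b 0.
  rewrite normr_le0 => /eqP ->; exists 0 => z; rewrite normr_le0 => /eqP ->.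
  by rewrite expr0n/= mul0r !addr0 mul0r addr0.
have {bn0}b0 : 0 < b by rewrite lt_def bn0.
move=> mb.
pose chord z := (1 + z / b) / 2 * expR b + (1 - z / b) / 2 * expR (- b).
exists ((expR b - expR (- b)) / (2 * b)) => z zb.
have zb1 x : `|x| <= b -> -1 <= x / b <= 1.
  by rewrite ler_norml ler_pdivrMr// ler_pdivlMr// mulN1r mul1r.
have zc : expR z <= chord z.
  have /andP[z1 z2] := zb1 _ zb.
  have t0 : 0 <= (1 + z / b) / 2 by lra.
  have t1 : (1 + z / b) / 2 <= 1 by lra.
  have H (t : R) : 0 <= t -> t <= 1 ->
      expR (t * b + (1 - t) * - b) <= t * expR b + (1 - t) * expR (- b).
    move=> t0' t1'; have := @convex_expR R (Itv01 t0' t1') b (- b).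
    by rewrite !convRE.
  have := H _ t0 t1; rewrite (_ : _ + _ * - b = z); last first.
    by field; rewrite gt_eqF.
  move=> /le_trans; apply; rewrite /chord; lra.
have cm : chord m <= expR (m + b ^+ 2 / 2).
  have := two_point_mgf_le (zb1 _ mb) (ltW b0).
  by rewrite divfK// gt_eqF.
apply: (le_trans zc).
have -> : chord z = chord m + (expR b - expR (- b)) / (2 * b) * (z - m).
  by rewrite /chord; field; rewrite gt_eqF.
by rewrite lerD2r.
Qed.

End hoeffding.

Section trigo.
Context {R : realType}.
Implicit Types t s u : R.

Lemma sin_le_id t : 0 <= t -> sin t <= t.
Proof.
move=> t0; rewrite -subr_ge0.
have dsin (x : R) : is_derive x 1 (fun x => x - sin x) (1 - cos x).
  by apply: is_derive_eq.
rewrite -[leLHS](subrr 0) -[X in _ - X <= _]sin0.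
by apply: (ge0_derivable_ge dsin) => // x _; rewrite subr_ge0 cos_le1.
Qed.

(** For unit vectors at angle t the left-hand side is the squared chordal
    distance. *)
Lemma cos_ge_parabola t : 0 <= t -> 2 - 2 * cos t <= t ^+ 2.
Proof.
move=> t0; rewrite -subr_ge0.
have dcos (x : R) : is_derive x 1 (fun x => x ^+ 2 - (2 - 2 * cos x))
    (2 * (x - sin x)).
  by apply: is_derive_eq; rewrite /GRing.scale/=; ring.
have := ge0_derivable_ge dcos.
rewrite cos0 expr0n/= mulr1 subrr subr0; apply => // x x0.
by rewrite mulr_ge0// subr_ge0 sin_le_id.
Qed.

Lemma acos_sq_ge s : -1 <= s <= 1 -> 2 - 2 * s <= acos s ^+ 2.
Proof.
move=> s1; have [/andP[a0 _] sE] := acos_def s1.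
by rewrite -{1}sE cos_ge_parabola.
Qed.

Lemma acos_lipschitz delta s t : 0 <= delta < 1 -> `|s| <= delta -> `|t| <= delta ->
  `|acos s - acos t| <= `|s - t| / Num.sqrt (1 - delta ^+ 2).
Proof.
move=> /andP[d0 d1].
have d2 : 0 < 1 - delta ^+ 2 by nra.
wlog st : s t / t < s.
  move=> H sd td; have [ts|st|->] := ltgtP t s; first exact: H.
    by rewrite distrC [in leRHS]distrC; exact: H.
  by rewrite !subrr normr0 mul0r.
move=> /[dup] /ler_normlP[s1 s2] _ /[dup] /ler_normlP[t1 t2] _.
have inI x : t <= x <= s -> -1 < x < 1.
  by move=> /andP[? ?]; apply/andP; split; lra.
have dacos x : x \in `]t, s[%R ->
    is_derive x 1 (@acos R) (- (Num.sqrt (1 - x ^+ 2))^-1).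
  move=> /[!in_itv]/= /andP[tx xs]; apply: is_derive1_acos; apply: inI.
  by rewrite !ltW.
have cacos : {within `[t, s], continuous (@acos R)}.
  apply: continuous_in_subspaceT => x /[!inE]/= /[!in_itv]/= xst.
  by apply: continuous_acos; exact: inI.
have [c /[!in_itv]/= /andP[tc cs] ->] := MVT st dacos cacos.
rewrite normrM normrN mulrC ler_wpM2l// normfV ger0_norm ?sqrtr_ge0//.
rewrite lef_pV2 ?posrE ?sqrtr_gt0//; last by nra.
by apply: ler_wsqrtr; nra.
Qed.

End trigo.

(** * Integrals of bounded measurable functions *)

Section bounded_measurable.
Context (d : measure_display) (T : measurableType d) (R : realType).
Implicit Types (p q : probability T R) (f g : T -> R).

(** From the first full step on, every function in the proof is of this kind. The
    class is closed under the operations used and consists of integrable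
    functions for any probability, so integrals of sums split without side
    conditions. *)
Definition bounded_measurable f : Prop :=
  measurable_fun setT f /\ exists M, forall x, `|f x| <= M.

Lemma bounded_measurable_cst (r : R) : bounded_measurable (fun=> r).
Proof. by split => //; exists `|r|. Qed.

Lemma bounded_measurableD f g : bounded_measurable f -> bounded_measurable g ->
  bounded_measurable (fun x => f x + g x).
Proof.
move=> [mf [M fM]] [mg [N gN]]; split; first exact: measurable_funD.
by exists (M + N) => x; rewrite (le_trans (ler_normD _ _))// lerD.
Qed.

Lemma bounded_measurableN f : bounded_measurable f ->
  bounded_measurable (fun x => - f x).
Proof.
move=> [mf [M fM]]; split; first exact: measurable_funN.
by exists M => x; rewrite normrN.
Qed.

Lemma bounded_measurableM f g : bounded_measurable f -> bounded_measurable g ->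
  bounded_measurable (fun x => f x * g x).
Proof.
move=> [mf [M fM]] [mg [N gN]]; split; first exact: measurable_funM.
by exists (M * N) => x; rewrite normrM ler_pM.
Qed.

Lemma bounded_measurable_expR f : bounded_measurable f ->
  bounded_measurable (fun x => expR (f x)).
Proof.
move=> [mf [M fM]]; split; first exact: measurableT_comp.
exists (expR M) => x; rewrite ger0_norm ?expR_ge0// ler_expR.
exact: le_trans (ler_norm _) (fM x).
Qed.

Lemma bounded_measurable_indic (A : set T) : measurable A ->
  bounded_measurable (\1_A : T -> R).
Proof.
move=> mA; split => //; exists 1 => x.
by rewrite indicE; case: (x \in A); rewrite ?normr1// normr0.
Qed.

Lemma bounded_measurable_integrable p f :
  bounded_measurable f -> p.-integrable setT (EFin \o f).
Proof.
move=> [mf [M fM]]; apply: measurable_bounded_integrable => //.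
  exact: (le_lt_trans (probability_le1 p measurableT) (ltry 1)).
exists M; split; first exact: num_real.
by move=> N MN x _ /=; rewrite (le_trans (fM x))// ltW.
Qed.

Lemma EFin_Rintegral p f : p.-integrable setT (EFin \o f) ->
  (\int[p]_x f x)%:E = (\int[p]_x (f x)%:E)%E.
Proof. by move=> pf; rewrite fineK//; exact: integrable_fin_num. Qed.

Lemma Rintegral_cst1 p (r : R) : \int[p]_x r = r.
Proof.
rewrite Rintegral_cst// (_ : fine _ = 1) ?mulr1//.
by rewrite -[RHS]/(fine 1%E); congr fine; exact: probability_setT.
Qed.

End bounded_measurable.

Lemma bounded_measurable_comp (d d' : measure_display) (T : measurableType d)
    (T' : measurableType d') (R : realType) (X : T -> T') (f : T' -> R) :
  measurable_fun setT X -> bounded_measurable f ->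
  bounded_measurable (fun x => f (X x)).
Proof.
move=> mX [mf [M fM]]; split; first exact: measurableT_comp.
by exists M.
Qed.

Section bounded_integrals.
Context (d : measure_display) (T : measurableType d) (R : realType).
Variable p : probability T R.
Implicit Types (f g : T -> R).
Let bmi := bounded_measurable_integrable.

Lemma bounded_RintegralD f g : bounded_measurable f -> bounded_measurable g ->
  \int[p]_x (f x + g x) = \int[p]_x f x + \int[p]_x g x.
Proof. by move=> bf bg; rewrite RintegralD//; exact: bmi. Qed.

Lemma bounded_RintegralB f g : bounded_measurable f -> bounded_measurable g ->
  \int[p]_x (f x - g x) = \int[p]_x f x - \int[p]_x g x.
Proof. by move=> bf bg; rewrite RintegralB//; exact: bmi. Qed.

Lemma bounded_RintegralZl f (r : R) : bounded_measurable f ->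
  \int[p]_x (r * f x) = r * \int[p]_x f x.
Proof. by move=> bf; rewrite RintegralZl//; exact: bmi. Qed.

Lemma bounded_le_Rintegral f g : bounded_measurable f -> bounded_measurable g ->
  (forall x, f x <= g x) -> \int[p]_x f x <= \int[p]_x g x.
Proof. by move=> bf bg fg; apply: le_Rintegral => //; exact: bmi. Qed.

Lemma EFin_Rintegral_indic (A : set T) : measurable A ->
  (\int[p]_x (\1_A x : R))%:E = p A.
Proof.
move=> mA; rewrite EFin_Rintegral ?integral_indic ?setIT//.
exact/bmi/bounded_measurable_indic.
Qed.

Lemma Rintegral_density (q : probability T R) f h :
  has_density q h p -> bounded_measurable f ->
  \int[p]_x f x = \int[q]_x (f x * h x).
Proof.
move=> ph [mf _]; rewrite /Rintegral (integral_density ph)//.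
exact/measurable_EFinP.
Qed.

End bounded_integrals.

Lemma Rintegral_law (d d' : measure_display) (T : measurableType d)
    (T' : measurableType d') (R : realType) (p : probability T R)
    (q : probability T' R) (X : T -> T') (h : T' -> R) :
  measurable_fun setT X -> bounded_measurable h ->
  (forall A, measurable A -> p (X @^-1` A) = q A) ->
  \int[p]_x h (X x) = \int[q]_y h y.
Proof.
move=> mX [mh _] pXq; rewrite /Rintegral.
by rewrite (integral_law (h := EFin \o h) mX _ pXq)//; exact/measurable_EFinP.
Qed.

(** Measurability is deduced from Tonelli's theorem for F + M, with M a bound of
    the absolute value of F. *)
Lemma bounded_measurable_Rintegral (d1 d2 : measure_display)
    (T1 : measurableType d1) (T2 : measurableType d2) (R : realType)
    (p : probability T1 R) (F : T1 * T2 -> R) : bounded_measurable F ->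
  bounded_measurable (fun y => \int[p]_x F (x, y)).
Proof.
move=> bF; have [mF [M FM]] := bF.
have bF2 y : bounded_measurable (fun x => F (x, y)).
  by apply: (bounded_measurable_comp _ bF); exact: measurable_pair2.
have bM := bounded_measurable_cst T1 M.
split.
  have -> : (fun y => \int[p]_x F (x, y)) =
      (fun y => fine (\int[p]_x (F (x, y) + M)%:E)%E - M).
    apply/funext => y; rewrite -[fine _]/(\int[p]_x (F (x, y) + M)).
    by rewrite bounded_RintegralD// Rintegral_cst1 addrK.
  apply: measurable_funB => //; apply: measurableT_comp => //.
  apply: (@measurable_fun_fubini_tonelli_G _ _ _ _ _ p
    (fun z => (F z + M)%:E)) => [|z].
    by apply/measurable_EFinP; exact: measurable_funD.
  by rewrite lee_fin -lerBlDr sub0r; have := FM z; rewrite ler_norml => /andP[].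
exists M => y.
have bn : bounded_measurable (fun x => `|F (x, y)|).
  by split; [exact: (measurableT_comp _ (bF2 y).1)|exists M => x; rewrite normr_id].
apply: (le_trans (le_normr_Rintegral _ _)) => //.
  exact/bounded_measurable_integrable.
by rewrite -[leRHS](Rintegral_cst1 p); apply: bounded_le_Rintegral.
Qed.

Section bounded_fubini.
Context (d1 d2 : measure_display) (T1 : measurableType d1)
  (T2 : measurableType d2) (R : realType).
Variables (p : probability T1 R) (q : probability T2 R) (F : T1 * T2 -> R).
Hypothesis bF : bounded_measurable F.

Let bF1 x : bounded_measurable (fun y => F (x, y)).
Proof. by apply: (bounded_measurable_comp _ bF); exact: measurable_pair1. Qed.

Let bF2 y : bounded_measurable (fun x => F (x, y)).
Proof. by apply: (bounded_measurable_comp _ bF); exact: measurable_pair2. Qed.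

Let imF : (p \x q)%E.-integrable setT (EFin \o F).
Proof. exact: (@bounded_measurable_integrable _ _ _ (p \x q)%E). Qed.

Lemma Rintegral_prod12 :
  \int[(p \x q)%E]_z F z = \int[p]_x (\int[q]_y F (x, y)).
Proof.
rewrite {1}/Rintegral -(integral12_prod_meas1 imF).
rewrite /Rintegral; congr fine; apply: eq_integral => x _.
by rewrite EFin_Rintegral//; exact: bounded_measurable_integrable.
Qed.

Lemma Rintegral_prod21 :
  \int[(p \x q)%E]_z F z = \int[q]_y (\int[p]_x F (x, y)).
Proof.
rewrite {1}/Rintegral -(integral21_prod_meas1 imF).
rewrite /Rintegral; congr fine; apply: eq_integral => x _.
by rewrite EFin_Rintegral//; exact: bounded_measurable_integrable.
Qed.

End bounded_fubini.

(** * One Sinkhorn half-step *)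

Lemma integral_gt0 (d : measure_display) (T : measurableType d) (R : realType)
    (p : probability T R) (f : T -> R) :
  measurable_fun setT f -> (forall x, 0 < f x) ->
  (0 < \int[p]_x (f x)%:E)%E.
Proof.
move=> mf f0; rewrite lt_neqAle integral_ge0 ?andbT; last first.
  by move=> x _; rewrite lee_fin ltW.
apply/eqP => /esym if0.
have [N [mN pN sN]] : ae_eq p setT (EFin \o f) (cst 0%E).
  apply/(ae_eq_integral_abs p measurableT); first exact/measurable_EFinP.
  by rewrite -[RHS]if0; apply: eq_integral => x _ /=; rewrite ger0_norm// ltW.
have NT : N = setT.
  by apply/seteqP; split => // x _; apply: sN => /(_ I)[]/eqP; rewrite gt_eqF.
have /eqP := etrans (esym pN) (etrans (congr1 p NT) (probability_setT p)).
by rewrite eq_sym onee_eq0.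
Qed.

(** The soft transform f |-> eps log (\int exp (-(c + f) / eps)) is one half-step of
    the algorithm; both half-steps are instances, the second one with the roles of
    the two spaces exchanged. Since c is bounded, the integral lies between two
    positive constants, so that the transform is bounded as soon as
    exp (-f / eps) is integrable. *)
Section soft_transform.
Context (d1 d2 : measure_display) (T1 : measurableType d1)
  (T2 : measurableType d2) (R : realType).
Variables (rho : probability T1 R) (c : T1 -> T2 -> R) (eps : R) (f : T1 -> R).
Hypotheses (eps0 : 0 < eps) (bc : bounded_measurable (fun z => c z.1 z.2))
  (hf : sinkhorn_init eps rho f).

Let w y x := expR (- (c x y + f x) / eps).

Let mw : measurable_fun setT (fun z : T1 * T2 => w z.2 z.1).
Proof.
have [mf _] := hf; apply: measurableT_comp => //.
apply: measurable_funM => //; apply: measurable_funN.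
by apply: measurable_funD; [exact: bc.1|exact: measurableT_comp].
Qed.

Let mwy y : measurable_fun setT (w y).
Proof. exact: (measurableT_comp mw (measurable_pair2 y)). Qed.

Let w0 y x : 0 < w y x. Proof. exact: expR_gt0. Qed.

Let e0 x : 0 < expR (- f x / eps). Proof. exact: expR_gt0. Qed.

Let w_bounds M y x : (forall z, `|c z.1 z.2| <= M) ->
  expR (- M / eps) * expR (- f x / eps) <= w y x <=
  expR (M / eps) * expR (- f x / eps).
Proof.
move=> cM; have := cM (x, y); rewrite /= ler_norml => /andP[c1 c2].
rewrite /w -!expRD !ler_expR -!mulrDl !ler_pM2r ?invr_gt0//.
by apply/andP; split; lra.
Qed.

Let iw y : rho.-integrable setT (fun x => (w y x)%:E).
Proof.
have [_ hi] := hf; have [_ [M cM]] := bc.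
have hM : rho.-integrable setT
    (fun x => ((expR (M / eps))%:E * (expR (- f x / eps))%:E)%E).
  exact: integrableZl.
apply: le_integrable hM => //; first exact/measurable_EFinP.
move=> x _; have /andP[_ wM] := w_bounds y x cM.
by rewrite -EFinM !gee0_abs ?lee_fin// ltW// mulr_gt0 ?expR_gt0.
Qed.

Let S := sinkhorn_psi c eps rho f.

Let Z_bounds : exists m M : R, [/\ 0 < m, 0 < M &
  forall y, m <= \int[rho]_x w y x <= M].
Proof.
have [mf hi] := hf; have [_ [M cM]] := bc.
have I0 : 0 < \int[rho]_x expR (- f x / eps).
  rewrite -lte_fin EFin_Rintegral//; apply: integral_gt0 => //.
  apply: measurableT_comp => //; apply: measurable_funM => //.
  exact: measurable_funN.
have hZ (r : R) : rho.-integrable setT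
    (EFin \o (fun x => r * expR (- f x / eps))).
  exact: (integrableZl measurableT r hi).
exists (expR (- M / eps) * \int[rho]_x expR (- f x / eps)),
  (expR (M / eps) * \int[rho]_x expR (- f x / eps)).
split; [by rewrite mulr_gt0 ?expR_gt0..|move=> y].
rewrite -!RintegralZl//; apply/andP; split; apply: le_Rintegral => //.
all: try exact: iw.
all: by move=> x _; have /andP[] := w_bounds y x cM.
Qed.

Lemma soft_transform_bounded : bounded_measurable S.
Proof.
have [m [M [m0 M0 ZmM]]] := Z_bounds.
split.
  apply: measurable_funM => //; apply: measurableT_comp => //.
  rewrite /Rintegral; apply: measurableT_comp => //.
  apply: (@measurable_fun_fubini_tonelli_G _ _ _ _ _ rho
    (fun z : T1 * T2 => (w z.2 z.1)%:E)) => [|z].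
    exact/measurable_EFinP.
  by rewrite lee_fin ltW.
exists (eps * (`|ln m| + `|ln M|)) => y.
have /andP[mZ ZM] := ZmM y.
have Z0 : 0 < \int[rho]_x w y x by exact: lt_le_trans mZ.
rewrite /S /sinkhorn_psi normrM (gtr0_norm eps0) ler_pM2l//.
have l1 : ln m <= ln (\int[rho]_x w y x) by rewrite ler_ln ?posrE.
have l2 : ln (\int[rho]_x w y x) <= ln M by rewrite ler_ln ?posrE.
have := ler_norm (- ln m); have := ler_norm (ln M); rewrite normrN.
have := normr_ge0 (ln m); have := normr_ge0 (ln M).
by rewrite ler_norml => *; apply/andP; split; lra.
Qed.

Lemma soft_transform_normalized y :
  (\int[rho]_x (expR (- (c x y + f x + S y) / eps))%:E = 1)%E.
Proof.
have [m [M [m0 M0 ZmM]]] := Z_bounds.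
have /andP[mZ ZM] := ZmM y.
have Z0 : 0 < \int[rho]_x w y x by exact: lt_le_trans mZ.
have Se : expR (- S y / eps) = (\int[rho]_x w y x)^-1.
  by rewrite mulNr /S /sinkhorn_psi mulrAC divff ?gt_eqF// mul1r expRN lnK ?posrE.
under eq_integral => x _.
  rewrite opprD mulrDl expRD Se mulrC EFinM; over.
rewrite /= integralZl//; last exact: iw.
by rewrite -EFin_Rintegral ?iw// -EFinM mulVf// gt_eqF.
Qed.

End soft_transform.

Lemma bounded_sinkhorn_init (d : measure_display) (T : measurableType d)
    (R : realType) (eps : R) (rho : probability T R) (phi : T -> R) :
  bounded_measurable phi -> sinkhorn_init eps rho phi.
Proof.
move=> bphi; split; first exact: bphi.1.
apply: (@bounded_measurable_integrable _ _ _ rho (fun x => expR (- phi x / eps))).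
apply: bounded_measurable_expR; apply: bounded_measurableM.
  exact: bounded_measurableN.
exact: bounded_measurable_cst.
Qed.

(** * Entropy of an optimal plan *)

Lemma lne_divr (R : realType) (u V : R) : 0 <= u ->
  lne (u / expR (- V))%:E = (lne u%:E + V%:E)%E.
Proof.
rewrite le_eqVlt => /predU1P[<-|u0].
  by rewrite mul0r le0_lneNy// addNye.
by rewrite !lne_EFin ?divr_gt0 ?expR_gt0// ln_div ?posrE ?expR_gt0// expRK opprK EFinD.
Qed.

Lemma lne_le_tangent (R : realType) (u k : R) : 0 <= u -> 0 < k ->
  (lne u%:E <= (ln k - 1 + u / k)%:E)%E.
Proof.
rewrite le_eqVlt => /predU1P[<- _|u0 k0]; first by rewrite le0_lneNy// leNye.
rewrite lne_EFin// lee_fin.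
by have := ln_le_subr1 (divr_gt0 u0 k0); rewrite ln_div ?posrE//; lra.
Qed.

(** Used with u the density of p: the negative part of the entropy integrand is
    always integrable, because u log u is bounded below. *)
Lemma funeneg_lne_mul_le1 (R : realType) (u : R) : 0 <= u ->
  (maxe (- lne u%:E) 0 * u%:E <= 1)%E.
Proof.
rewrite le_eqVlt => /predU1P[<-|u0]; first by rewrite mule0.
rewrite lne_EFin// -EFinN -EFin_max -EFinM lee_fin.
rewrite maxr_pMl ?(ltW u0)// mul0r ge_max ler01 andbT.
have iu0 : 0 < u^-1 by rewrite invr_gt0.
have := ln_le_subr1 iu0; rewrite lnV ?posrE// => /(ler_wpM2r (ltW u0)).
by rewrite mulrBl mulVf ?gt_eqF// mul1r => /le_trans; apply; lra.
Qed.

Lemma entropy_self (d : measure_display) (T : measurableType d) (R : realType)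
  (m : probability T R) : entropy m m = 0%E.
Proof.
rewrite (entropy_density (has_density_unit m) (has_density_unit m))//.
by under eq_integral do rewrite divr1 lne1; rewrite integral0.
Qed.

(** Finite entropy excludes the value +oo of the integral of the positive part,
    and the negative part is always integrable. *)
Lemma entropy_lty_density (d : measure_display) (T : measurableType d)
    (R : realType) (m p : probability T R) :
  (entropy p m < +oo)%E -> exists f, [/\ has_density m f p,
    p.-integrable setT (fun x => lne (f x)%:E) &
    entropy p m = (\int[p]_x lne (f x)%:E)%E].
Proof.
move=> Hfin; have pm : p `<< m.
  by move: Hfin; rewrite /entropy; case: asboolP.
have [f mfp] := density_of_dominated pm; have [mf f0 _] := mfp.
have HE : entropy p m = (\int[p]_x lne (f x)%:E)%E.
  rewrite (entropy_density mfp (has_density_unit m))//.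
  by apply: eq_integral => x _; rewrite divr1.
exists f; split => //.
have ml := measurable_lne_EFin mf.
set l := fun x => lne (f x)%:E in ml *.
have neg1 : (\int[p]_x l^\- x <= 1)%E.
  rewrite (integral_density mfp); last exact: measurable_funeneg.
  rewrite -[leRHS](@probability_setT _ _ _ m) -[m setT]mul1e.
  rewrite -(integral_cst m measurableT 1%E).
  apply: ge0_le_integral => //.
  - by move=> x _; rewrite mule_ge0// lee_fin.
  - apply: emeasurable_funM; first exact: measurable_funeneg.
    exact/measurable_EFinP.
  - by move=> x _; rewrite funenegE; exact: funeneg_lne_mul_le1.
apply/integrableP; split => //.
under eq_integral => x _ do rewrite -/((abse \o l) x) fune_abse.
rewrite ge0_integralD//; [|exact: measurable_funepos|exact: measurable_funeneg].
have negfin : (\int[p]_x l^\- x < +oo)%E by exact: le_lt_trans (ltry 1).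
rewrite lte_add_pinfty// ltey; apply/eqP => posoo.
move: Hfin; rewrite HE integralE posoo.
suff : (\int[p]_x l^\- x)%E \is a fin_num by case: (\int[p]_x l^\- x)%E.
by rewrite ge0_fin_numE//; exact: integral_ge0.
Qed.

Section coupling.
Context (d1 d2 : measure_display) (T1 : measurableType d1)
  (T2 : measurableType d2) (R : realType).
Variables (rho : probability T1 R) (nu : probability T2 R).
Variable gamma : probability (T1 * T2)%type R.
Hypothesis Cgamma : coupling rho nu gamma.

Lemma coupling_fst (A : set T1) : measurable A -> gamma (fst @^-1` A) = rho A.
Proof.
move=> mA; rewrite -Cgamma.1//; congr (gamma _).
by apply/seteqP; split => x //= -[].
Qed.

Lemma coupling_snd (B : set T2) : measurable B -> gamma (snd @^-1` B) = nu B.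
Proof.
move=> mB; rewrite -Cgamma.2//; congr (gamma _).
by apply/seteqP; split => x //= -[].
Qed.

Lemma coupling_Rintegral_fst (h : T1 -> R) : bounded_measurable h ->
  \int[gamma]_z h z.1 = \int[rho]_x h x.
Proof. by move=> bh; apply: Rintegral_law coupling_fst. Qed.

Lemma coupling_Rintegral_snd (h : T2 -> R) : bounded_measurable h ->
  \int[gamma]_z h z.2 = \int[nu]_x h x.
Proof. by move=> bh; apply: Rintegral_law coupling_snd. Qed.

End coupling.

Lemma product_coupling (d1 d2 : measure_display) (T1 : measurableType d1)
    (T2 : measurableType d2) (R : realType) (rho : probability T1 R)
    (nu : probability T2 R) : coupling rho nu (rho \x nu)%E.
Proof.
split=> A mA /=.
  by rewrite product_measure1E// [X in (_ * X)%E]probability_setT mule1.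
by rewrite product_measure1E// [X in (X * _)%E]probability_setT mul1e.
Qed.

Section optimal_plan.
Context (d1 d2 : measure_display) (T1 : measurableType d1)
  (T2 : measurableType d2) (R : realType).
Variables (rho : probability T1 R) (nu : probability T2 R) (c : T1 -> T2 -> R)
  (eps : R) (gamma : probability (T1 * T2)%type R).
Hypotheses (eps0 : 0 < eps) (bc : bounded_measurable (fun z => c z.1 z.2))
  (hgamma : eot_plan c eps rho nu gamma).

(** The product plan is a competitor with finite cost and zero entropy. *)
Lemma eot_plan_entropy_lty : (entropy gamma (rho \x nu)%E < +oo)%E.
Proof.
have [_ /(_ _ (product_coupling rho nu))] := hgamma.
rewrite /eot_cost entropy_self mule0 adde0.
rewrite -!EFin_Rintegral; [|exact: (@bounded_measurable_integrable _ _ _ _ _ bc)..].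
by case: (entropy _ _) => [r|//|//] /=; rewrite ?ltry// gt0_muley ?lte_fin.
Qed.

End optimal_plan.

(** * The Sinkhorn iterates and their marginals *)

(** The inequality 1 + t <= exp t at t = v - u, multiplied by p. *)
Lemma relative_density_le (R : realType) (u v p : R) : 0 < p ->
  v * p <= u * p + (expR v * (p * expR (- u)) - p).
Proof.
move=> p0; have -> : u * p + (expR v * (p * expR (- u)) - p)
    = (u + expR (v - u) - 1) * p by rewrite expRD; ring.
by rewrite ler_pM2r//; have := expR_ge1Dx (v - u); lra.
Qed.

Section iterates.
Context (d1 d2 : measure_display) (T1 : measurableType d1)
  (T2 : measurableType d2) (R : realType).
Variables (rho : probability T1 R) (nu : probability T2 R)
  (c : T1 -> T2 -> R) (eps : R) (phi0 : T1 -> R).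
Hypotheses (eps0 : 0 < eps) (bc : bounded_measurable (fun z => c z.1 z.2))
  (hphi0 : sinkhorn_init eps rho phi0).

Definition iter_phi n := sinkhorn_phi c eps rho nu phi0 n.
Definition iter_psi n := sinkhorn_psi c eps rho (iter_phi n).
(** Density of pi^{n,n} with respect to rho \x nu. *)
Definition full_step_density n z := sinkhorn_density c eps rho nu phi0 n z.
(** Density of pi^{n+1,n} with respect to rho \x nu. *)
Definition half_step_density n (z : T1 * T2) :=
  expR (- (c z.1 z.2 + iter_psi n z.2 + iter_phi n.+1 z.1) / eps).
(** The first marginal of pi^{n,n} has density exp (- logratio_rho n) with respect
    to rho. *)
Definition logratio_rho n x := (iter_phi n x - iter_phi n.+1 x) / eps.
(** The second marginal of pi^{n+1,n} has density exp (logratio_nu n) with respect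
    to nu. *)
Definition logratio_nu n y := (iter_psi n.+1 y - iter_psi n y) / eps.
(** Minus the logarithm of the density of pi^{n,n}. *)
Definition potential n (z : T1 * T2) := (c z.1 z.2 + iter_phi n z.1 + iter_psi n z.2) / eps.

Let bc' : bounded_measurable (fun z : T2 * T1 => c z.2 z.1).
Proof.
have mX : measurable_fun setT (fun z : T2 * T1 => (z.2, z.1)).
  by apply: measurable_fun_pair.
exact: (bounded_measurable_comp mX bc).
Qed.

Lemma iter_phi_init n : sinkhorn_init eps rho (iter_phi n).
Proof.
elim: n => [//|n ih]; apply: bounded_sinkhorn_init.
apply: (@soft_transform_bounded _ _ _ _ _ nu (fun y x => c x y)) => //.
by apply: bounded_sinkhorn_init; exact: soft_transform_bounded.
Qed.

Lemma iter_psi_bounded n : bounded_measurable (iter_psi n).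
Proof. exact: soft_transform_bounded (iter_phi_init n). Qed.

Lemma iter_phi_bounded n : bounded_measurable (iter_phi n.+1).
Proof.
apply: (@soft_transform_bounded _ _ _ _ _ nu (fun y x => c x y)) => //.
by apply: bounded_sinkhorn_init; exact: iter_psi_bounded.
Qed.

Lemma full_step_density_normalized n y : (\int[rho]_x (full_step_density n (x, y))%:E = 1)%E.
Proof. exact: (soft_transform_normalized eps0 bc (iter_phi_init n)). Qed.

Lemma half_step_density_normalized n x : (\int[nu]_y (half_step_density n (x, y))%:E = 1)%E.
Proof.
apply: (@soft_transform_normalized _ _ _ _ _ nu (fun y x => c x y)) => //.
by apply: bounded_sinkhorn_init; exact: iter_psi_bounded.
Qed.

Lemma full_step_densityE n z : full_step_density n z = expR (- potential n z).
Proof. by rewrite /potential -mulNr. Qed.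

(* Otherwise unification unfolds the recursion of the iterates. *)
Opaque iter_phi iter_psi.

Lemma full_step_of_half n z : full_step_density n z = half_step_density n z * expR (- logratio_rho n z.1).
Proof.
rewrite full_step_densityE /half_step_density -expRD; congr expR.
rewrite /potential /logratio_rho.
move: (c _ _) (iter_phi n _) (iter_phi n.+1 _) (iter_psi n _) => u v w t.
by field; rewrite gt_eqF.
Qed.

Lemma half_step_of_full n z : half_step_density n z = full_step_density n.+1 z * expR (logratio_nu n z.2).
Proof.
rewrite full_step_densityE /half_step_density -expRD; congr expR.
rewrite /potential /logratio_nu.
move: (c _ _) (iter_phi n.+1 _) (iter_psi n _) (iter_psi n.+1 _) => u v w t.
by field; rewrite gt_eqF.
Qed.

Lemma logratio_nu_bounded n : bounded_measurable (logratio_nu n).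
Proof.
apply: bounded_measurableM; last exact: bounded_measurable_cst.
apply: bounded_measurableD; first exact: iter_psi_bounded.
by apply: bounded_measurableN; exact: iter_psi_bounded.
Qed.

Lemma logratio_rho_bounded n : bounded_measurable (logratio_rho n.+1).
Proof.
apply: bounded_measurableM; last exact: bounded_measurable_cst.
apply: bounded_measurableD; first exact: iter_phi_bounded.
by apply: bounded_measurableN; exact: iter_phi_bounded.
Qed.

Lemma measurable_logratio_rho n : measurable_fun setT (logratio_rho n).
Proof.
apply: measurable_funM => //; apply: measurable_funB.
  by have [] := iter_phi_init n.
by have [] := iter_phi_init n.+1.
Qed.

Lemma potential_bounded n : bounded_measurable (potential n.+1).
Proof.
apply: bounded_measurableM; last exact: bounded_measurable_cst.
apply: bounded_measurableD; last exact: (bounded_measurable_comp _ (iter_psi_bounded _)).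
by apply: bounded_measurableD => //; exact: (bounded_measurable_comp _ (iter_phi_bounded _)).
Qed.

Lemma measurable_potential n : measurable_fun setT (potential n).
Proof.
apply: measurable_funM => //; apply: measurable_funD.
  apply: measurable_funD; first exact: bc.1.
  by have [m _] := iter_phi_init n; exact: measurableT_comp.
exact: (bounded_measurable_comp _ (iter_psi_bounded _)).1.
Qed.

Lemma potentialB n z :
  potential n z = potential n.+1 z + logratio_rho n z.1 - logratio_nu n z.2.
Proof.
rewrite /potential /logratio_rho /logratio_nu.
move: (c _ _) (iter_phi n _) (iter_phi n.+1 _) (iter_psi n _) (iter_psi n.+1 _) => u v w t s.
by field; rewrite gt_eqF.
Qed.

Lemma measurable_full_step_density n : measurable_fun setT (full_step_density n).
Proof.
have -> : full_step_density n = fun z => expR (- potential n z).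
  by apply/funext => z; rewrite full_step_densityE.
by apply: measurableT_comp => //; apply: measurable_funN; exact: measurable_potential.
Qed.

Lemma full_step_density_bounded n : bounded_measurable (full_step_density n.+1).
Proof.
have -> : full_step_density n.+1 = fun z => expR (- potential n.+1 z).
  by apply/funext => z; rewrite full_step_densityE.
by apply: bounded_measurable_expR; apply: bounded_measurableN; exact: potential_bounded.
Qed.

Lemma half_step_density_bounded n : bounded_measurable (half_step_density n).
Proof.
have -> : half_step_density n = fun z => full_step_density n.+1 z * expR (logratio_nu n z.2).
  by apply/funext => z; rewrite half_step_of_full.
apply: bounded_measurableM; first exact: full_step_density_bounded.
apply: bounded_measurable_expR.
by apply: (bounded_measurable_comp _ (logratio_nu_bounded _)).
Qed.

Lemma full_step_density_gt0 n z : 0 < full_step_density n z. Proof. exact: expR_gt0. Qed.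
Lemma half_step_density_gt0 n z : 0 < half_step_density n z. Proof. exact: expR_gt0. Qed.

Lemma full_step_density_mass n : (\int[(rho \x nu)%E]_z (full_step_density n z)%:E = 1)%E.
Proof.
rewrite fubini_tonelli2.
- under eq_integral do rewrite /fubini_G full_step_density_normalized.
  by rewrite (integral_cst nu measurableT 1%E) mul1e; exact: probability_setT.
- by apply/measurable_EFinP; exact: measurable_full_step_density.
- by move=> z; rewrite lee_fin ltW// full_step_density_gt0.
Qed.

Lemma logratio_rho_mass n : (\int[rho]_x (expR (- logratio_rho n x))%:E = 1)%E.
Proof.
rewrite -(full_step_density_mass n) fubini_tonelli1.
- apply: eq_integral => x _; rewrite /fubini_F.
  under eq_integral do rewrite full_step_of_half mulrC EFinM /=.
  rewrite integralZl//= ?half_step_density_normalized ?mule1//.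
  apply: (@bounded_measurable_integrable _ _ _ nu (fun y => half_step_density n (x, y))).
  by apply: (bounded_measurable_comp _ (half_step_density_bounded n)); exact: measurable_pair1.
- by apply/measurable_EFinP; exact: measurable_full_step_density.
- by move=> z; rewrite lee_fin ltW// full_step_density_gt0.
Qed.

Lemma half_step_density_nu n y : \int[rho]_x half_step_density n (x, y) = expR (logratio_nu n y).
Proof.
under eq_Rintegral do rewrite half_step_of_full mulrC /=.
rewrite bounded_RintegralZl; last first.
  by apply: (bounded_measurable_comp _ (full_step_density_bounded n)); exact: measurable_pair2.
by rewrite /Rintegral full_step_density_normalized mulr1.
Qed.

Lemma half_step_density_rho n x : \int[nu]_y half_step_density n (x, y) = 1.
Proof. by rewrite /Rintegral half_step_density_normalized. Qed.

Lemma half_step_density_mass n : \int[(rho \x nu)%E]_z half_step_density n z = 1.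
Proof.
rewrite Rintegral_prod12; last exact: half_step_density_bounded.
by under eq_Rintegral do rewrite half_step_density_rho; rewrite Rintegral_cst1.
Qed.

Lemma logratio_nu_mass n : \int[nu]_y expR (logratio_nu n y) = 1.
Proof.
rewrite -(half_step_density_mass n) Rintegral_prod21; last exact: half_step_density_bounded.
by apply: eq_Rintegral => y _; rewrite half_step_density_nu.
Qed.

(** The opposite of the left-hand side is the entropy of nu relative to the second
    marginal of pi^{n+1,n}. *)
Lemma logratio_nu_le0 n : \int[nu]_y logratio_nu n y <= 0.
Proof.
have be := bounded_measurable_expR (logratio_nu_bounded n).
have b1 : bounded_measurable (fun=> 1 : R) := bounded_measurable_cst T2 1.
rewrite -[leRHS](subrr 1) -{1}(logratio_nu_mass n) -[X in _ - X](Rintegral_cst1 nu).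
rewrite -bounded_RintegralB//; apply: bounded_le_Rintegral => //.
- exact: logratio_nu_bounded.
- by apply: bounded_measurableD => //; exact: bounded_measurableN.
- by move=> y; rewrite lerBrDr addrC expR_ge1Dx.
Qed.

(** The left-hand side is H(nu^{n+1} | nu), the right-hand side H(rho | rho^{n+1}),
    and the inequality is the monotonicity of entropy under the projection to the
    second factor. It is obtained by integrating b <= a + exp (b - a) - 1 against
    pi^{n+2,n+1}: the density of that plan times exp (-a) is the density of
    pi^{n+1,n+1}, so that the exponential term has integral 1. *)
Lemma marginal_entropy_le n :
  \int[nu]_y (logratio_nu n.+1 y * expR (logratio_nu n.+1 y))
  <= \int[rho]_x logratio_rho n.+1 x.
Proof.
set a := logratio_rho n.+1; set b := logratio_nu n.+1; set P := half_step_density n.+1.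
have ba : bounded_measurable a := logratio_rho_bounded n.
have bb : bounded_measurable b := logratio_nu_bounded n.+1.
have bP : bounded_measurable P := half_step_density_bounded n.+1.
have ba1 : bounded_measurable (fun z : T1 * T2 => a z.1).
  exact: (bounded_measurable_comp _ ba).
have bb2 : bounded_measurable (fun z : T1 * T2 => b z.2).
  exact: (bounded_measurable_comp _ bb).
have baP := bounded_measurableM ba1 bP.
have bbP := bounded_measurableM bb2 bP.
have beK := bounded_measurableM (bounded_measurable_expR bb2) (full_step_density_bounded n).
have bP1 x : bounded_measurable (fun y => P (x, y)).
  by apply: (bounded_measurable_comp _ bP); exact: measurable_pair1.
have bP2 y : bounded_measurable (fun x => P (x, y)).
  by apply: (bounded_measurable_comp _ bP); exact: measurable_pair2.
have Ib : \int[(rho \x nu)%E]_z (b z.2 * P z) = \int[nu]_y (b y * expR (b y)).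
  rewrite (Rintegral_prod21 _ _ bbP); apply: eq_Rintegral => y _.
  by rewrite (bounded_RintegralZl rho (b y) (bP2 y)) half_step_density_nu.
have Ia : \int[(rho \x nu)%E]_z (a z.1 * P z) = \int[rho]_x a x.
  rewrite (Rintegral_prod12 _ _ baP); apply: eq_Rintegral => x _.
  by rewrite (bounded_RintegralZl nu (a x) (bP1 x)) half_step_density_rho mulr1.
have Ie : \int[(rho \x nu)%E]_z (expR (b z.2) * full_step_density n.+1 z) = 1.
  rewrite (Rintegral_prod21 _ _ beK) -[RHS](logratio_nu_mass n.+1).
  apply: eq_Rintegral => y _.
  have bKy : bounded_measurable (fun x => full_step_density n.+1 (x, y)).
    by apply: (bounded_measurable_comp _ (full_step_density_bounded n)); exact: measurable_pair2.
  rewrite (bounded_RintegralZl rho (expR (b y)) bKy).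
  by rewrite /Rintegral full_step_density_normalized mulr1.
have bR := bounded_measurableD baP (bounded_measurableD beK (bounded_measurableN bP)).
have : \int[(rho \x nu)%E]_z (b z.2 * P z) <= \int[(rho \x nu)%E]_z
    (a z.1 * P z + (expR (b z.2) * full_step_density n.+1 z - P z)).
  apply: (@bounded_le_Rintegral _ _ _ (rho \x nu)%E _ _ bbP bR) => z.
  have -> : full_step_density n.+1 z = P z * expR (- a z.1) by exact: full_step_of_half.
  by apply: relative_density_le; exact: half_step_density_gt0.
rewrite (@bounded_RintegralD _ _ _ (rho \x nu)%E)//; last first.
  by apply: bounded_measurableD => //; exact: bounded_measurableN.
rewrite (@bounded_RintegralB _ _ _ (rho \x nu)%E)// Ib Ia Ie half_step_density_mass.
by rewrite subrr addr0.
Qed.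

End iterates.

(** * Stability of the optimal plan in its second marginal *)

Lemma expR_balance (R : realType) (u v t w : R) : u + v + t = w ->
  expR (- u) * expR (- v) = expR t * expR (- w).
Proof. by move=> <-; rewrite -!expRD; congr expR; ring. Qed.

Lemma exists_pushforward (d d' : measure_display) (T : measurableType d)
    (T' : measurableType d') (R : realType) (p : probability T R) (X : T -> T') :
  measurable_fun setT X ->
  exists q : probability T' R, forall A, q A = p (X @^-1` A).
Proof.
move=> mX.
pose X' : {mfun T >-> T'} := HB.pack X (isMeasurableFun.Build _ _ _ _ X mX).
by exists (distribution p X' : probability T' R).
Qed.

Section stability.
Context (d1 d2 : measure_display) (T1 : measurableType d1)
  (T2 : measurableType d2) (R : realType).
Variables (rho : probability T1 R) (nu : probability T2 R)
  (c : T1 -> T2 -> R) (eps : R) (phi0 : T1 -> R).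
Hypotheses (eps0 : 0 < eps) (bc : bounded_measurable (fun z => c z.1 z.2))
  (hphi0 : sinkhorn_init eps rho phi0).

Local Notation K n := (full_step_density rho nu c eps phi0 n).
Local Notation P n := (half_step_density rho nu c eps phi0 n).
Local Notation V n := (potential rho nu c eps phi0 n).
Local Notation b n := (logratio_nu rho nu c eps phi0 n).
Local Notation psi n := (iter_psi rho nu c eps phi0 n).
Local Notation phi n := (iter_phi rho nu c eps phi0 n).

Let bK n : bounded_measurable (K n.+1) := full_step_density_bounded nu eps0 bc hphi0 n.
Let bV n : bounded_measurable (V n.+1) := potential_bounded nu eps0 bc hphi0 n.

Let bK2 n y : bounded_measurable (fun x => K n.+1 (x, y)).
Proof. by apply: (bounded_measurable_comp _ (bK n)); exact: measurable_pair2. Qed.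

Let K1 n y : \int[rho]_x K n.+1 (x, y) = 1.
Proof. by rewrite /Rintegral (full_step_density_normalized nu eps0 bc hphi0). Qed.

(** The left-hand side is the entropy of p^y' relative to p^y, where p^z is the law
    with density K n.+1 (., z). With X x = (c x y - c x y') / eps it equals
    log E[exp (- X)] + E[X] under p^y', to which Hoeffding's lemma applies. *)
Lemma conditional_entropy_le n (y y' : T2) (B : R) : 0 <= B ->
  (forall x, `|c x y - c x y'| <= B) ->
  \int[rho]_x ((V n.+1 (x, y) - V n.+1 (x, y')) * K n.+1 (x, y'))
    <= (B / eps) ^+ 2 / 2.
Proof.
move=> B0 cB; set X := fun x => (c x y - c x y') / eps.
set k := fun x => K n.+1 (x, y'); set be := B / eps.
have be0 : 0 <= be by rewrite divr_ge0// ltW.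
have bcy z : bounded_measurable (fun x => c x z).
  by apply: (bounded_measurable_comp _ bc (X := fun x => (x, z))); exact: measurable_pair2.
have bX : bounded_measurable X.
  apply: bounded_measurableM; last exact: bounded_measurable_cst.
  by apply: bounded_measurableD => //; exact: bounded_measurableN.
have bk : bounded_measurable k by exact: bK2.
have bXk := bounded_measurableM bX bk.
have k0 x : 0 <= k x by rewrite ltW// full_step_density_gt0.
have Xbe x : `|X x| <= be.
  by rewrite normrM (gtr0_norm (x := eps^-1)) ?invr_gt0// ler_pM2r ?invr_gt0.
have Ibe (r : R) : \int[rho]_x (r * k x) = r.
  by rewrite bounded_RintegralZl// K1 mulr1.
have bZ (r : R) : bounded_measurable (fun x => r * k x).
  by apply: bounded_measurableM => //; exact: bounded_measurable_cst.
set EX := \int[rho]_x (X x * k x).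
have EXbe : `|- EX| <= be.
  rewrite normrN ler_norml; apply/andP; split.
    rewrite -(Ibe (- be)); apply: bounded_le_Rintegral => // x.
    by rewrite ler_wpM2r//; have := Xbe x; rewrite ler_norml => /andP[].
  rewrite -[leRHS](Ibe be); apply: bounded_le_Rintegral => // x.
  by rewrite ler_wpM2r//; have := Xbe x; rewrite ler_norml => /andP[].
set t := (psi n.+1 y - psi n.+1 y') / eps.
have -> : \int[rho]_x ((V n.+1 (x, y) - V n.+1 (x, y')) * k x) = EX + t.
  rewrite -(Ibe t) -bounded_RintegralD//; apply: eq_Rintegral => x _.
  rewrite -mulrDl; congr (_ * _); rewrite /potential /X /t.
  move: (c x y) (c x y') (phi n.+1 x) (psi n.+1 y) (psi n.+1 y') => u u' v w w'.
  rewrite /=.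
  by field; rewrite gt_eqF.
(* The tilted law exp (-X) p^y' is proportional to p^y, which has mass 1. *)
have expt : \int[rho]_x (expR (- X x) * k x) = expR t.
  transitivity (\int[rho]_x (expR t * K n.+1 (x, y))); last first.
    by rewrite (bounded_RintegralZl rho (expR t) (bK2 n y)) K1 mulr1.
  apply: eq_Rintegral => x _; rewrite /k full_step_densityE [in RHS]full_step_densityE.
  apply: expR_balance.
  rewrite /potential /X /t.
  move: (c x y) (c x y') (phi n.+1 x) (psi n.+1 y) (psi n.+1 y') => u u' v w w'.
  rewrite /=.
  by field; rewrite gt_eqF.
have [s hs] := hoeffding_tangent be0 EXbe.
set E0 := expR (- EX + be ^+ 2 / 2) in hs.
have bsXk : bounded_measurable (fun x => (- s) * (X x * k x)).
  by apply: bounded_measurableM => //; exact: bounded_measurable_cst.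
have : expR t <= E0.
  rewrite -expt; apply: (@le_trans _ _ (\int[rho]_x
      ((E0 + s * EX) * k x + (- s) * (X x * k x)))).
    apply: bounded_le_Rintegral => //.
    - apply: bounded_measurableM => //; apply: bounded_measurable_expR.
      exact: bounded_measurableN.
    - exact: bounded_measurableD.
    - move=> x; have -> : (E0 + s * EX) * k x + (- s) * (X x * k x)
          = (E0 + s * (- X x - - EX)) * k x.
        move: (k x) (X x) (EX) (E0) => p q u v; ring.
      by rewrite ler_wpM2r// hs// normrN.
  rewrite bounded_RintegralD// Ibe bounded_RintegralZl// -/EX.
  have -> // : E0 + s * EX + - s * EX = E0.
  by move: (EX) (E0) => u v; ring.
by rewrite ler_expR; lra.
Qed.

Variables (gamma : probability (T1 * T2)%type R)
  (hgamma : eot_plan c eps rho nu gamma) (n : nat) (nun : probability T2 R)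
  (hnun : has_density nu (fun y => expR (b n y)) nun)
  (alpha : probability (T2 * T2)%type R) (Calpha : coupling nun nu alpha).

Let X (w : T1 * (T2 * T2)) : T1 * T2 := (w.1, w.2.2).
Let Y (w : T1 * (T2 * T2)) : T1 * T2 := (w.1, w.2.1).

Let mX : measurable_fun setT X.
Proof. by apply: measurable_fun_pair => //; exact: measurableT_comp. Qed.

Let mY : measurable_fun setT Y.
Proof. by apply: measurable_fun_pair => //; exact: measurableT_comp. Qed.

Let bKY : bounded_measurable (fun w => K n.+1 (Y w)).
Proof. exact: (bounded_measurable_comp mY (bK n)). Qed.

(** A point w = (x, (y', y)) carries a pair (y', y) drawn from alpha and a point x
    drawn from p^y': X w is the competitor, Y w the pair that determines the
    density. Forgetting y' turns rho \x alpha into rho \x nu. *)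
Let glued_law A : measurable A ->
  (rho \x alpha)%E (X @^-1` A) = (rho \x nu)%E A.
Proof.
move=> mA; have mXA : measurable (X @^-1` A).
  by rewrite -[X in measurable X]setTI; exact: mX.
rewrite -[LHS](@EFin_Rintegral_indic _ _ _ (rho \x alpha)%E)//.
rewrite -[RHS](@EFin_Rintegral_indic _ _ _ (rho \x nu)%E)//; congr EFin.
have bA : bounded_measurable (\1_A : T1 * T2 -> R) by exact: bounded_measurable_indic.
rewrite Rintegral_prod12; last exact: bounded_measurable_indic.
rewrite Rintegral_prod12//; apply: eq_Rintegral => x _.
rewrite -(coupling_Rintegral_snd Calpha); last first.
  by apply: (bounded_measurable_comp _ bA); exact: measurable_pair1.
by apply: eq_Rintegral => v _.
Qed.

Let glued_density : exists Q : probability (T1 * (T2 * T2))%type R,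
  has_density (rho \x alpha)%E (fun w => K n.+1 (Y w)) Q.
Proof.
apply: exists_density; first exact: bKY.1.
  by move=> w; rewrite ltW// full_step_density_gt0.
rewrite -(@EFin_Rintegral _ _ _ (rho \x alpha)%E); last first.
  exact: (@bounded_measurable_integrable _ _ _ (rho \x alpha)%E).
rewrite Rintegral_prod21//.
congr EFin; rewrite -[RHS](Rintegral_cst1 alpha).
by apply: eq_Rintegral => v _; exact: K1.
Qed.

Let glued_fst Q (g : T1 -> R) :
  has_density (rho \x alpha)%E (fun w => K n.+1 (Y w)) Q ->
  bounded_measurable g -> \int[Q]_w g w.1 = \int[rho]_x g x.
Proof.
move=> hQ bg.
have bg1 : bounded_measurable (fun w : T1 * (T2 * T2) => g w.1).
  exact: (bounded_measurable_comp _ bg).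
rewrite (Rintegral_density hQ)// Rintegral_prod12; last exact: bounded_measurableM.
apply: eq_Rintegral => x _.
have bKx : bounded_measurable (fun y => K n.+1 (x, y)).
  by apply: (bounded_measurable_comp _ (bK n)); exact: measurable_pair1.
have bKx1 : bounded_measurable (fun v : T2 * T2 => K n.+1 (x, v.1)).
  exact: (bounded_measurable_comp _ bKx).
rewrite (bounded_RintegralZl alpha (g x) bKx1) (coupling_Rintegral_fst Calpha bKx).
rewrite (Rintegral_density hnun bKx).
under eq_Rintegral do rewrite -(half_step_of_full rho nu c phi0 eps0 n (x, _)).
by rewrite (half_step_density_rho nu eps0 bc hphi0) mulr1.
Qed.

Let glued_snd Q (g : T2 -> R) :
  has_density (rho \x alpha)%E (fun w => K n.+1 (Y w)) Q ->
  bounded_measurable g -> \int[Q]_w g w.2.2 = \int[nu]_y g y.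
Proof.
move=> hQ bg.
have bg1 : bounded_measurable (fun w : T1 * (T2 * T2) => g w.2.2).
  by apply: (bounded_measurable_comp _ bg); exact: measurableT_comp.
rewrite (Rintegral_density hQ)// Rintegral_prod21; last exact: bounded_measurableM.
rewrite -(coupling_Rintegral_snd Calpha bg).
apply: eq_Rintegral => v _.
by rewrite (bounded_RintegralZl rho (g v.2) (bK2 n v.1)) K1 mulr1.
Qed.

(** The competitor is the law Q' of X under the glued law Q. Its entropy relative to
    rho \x nu is at most the Q-average of log K (Y w): this is again a projection
    argument, here the tangent inequality log g <= log k - 1 + g / k with g the
    density of Q' and k that of Q. *)
Lemma stability f :
  has_density (rho \x nu)%E f gamma ->
  gamma.-integrable setT (fun z => lne (f z)%:E) ->
  entropy gamma (rho \x nu)%E = (\int[gamma]_z lne (f z)%:E)%E ->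
  fine (\int[gamma]_z lne (f z)%:E)%E + \int[gamma]_z V n.+1 z <=
  \int[alpha]_v (\int[rho]_x
     ((V n.+1 (x, v.2) - V n.+1 (x, v.1)) * K n.+1 (x, v.1))).
Proof.
move=> hf If Hf; have [Q hQ] := glued_density.
have [Q' Q'E] := exists_pushforward Q mX.
have mpre A : measurable A -> measurable (X @^-1` A).
  by move=> mA; rewrite -[X in measurable X]setTI; exact: mX.
have CQ' : coupling rho nu Q'.
  split=> A mA.
    have bA : bounded_measurable (\1_A : T1 -> R) by exact: bounded_measurable_indic.
    rewrite Q'E -(@EFin_Rintegral_indic _ _ _ Q) -?(@EFin_Rintegral_indic _ _ _ rho)//;
      last by apply: mpre; exact: measurableX.
    rewrite -(glued_fst hQ bA); congr EFin; apply: eq_Rintegral => w _.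
    rewrite !indicE; congr ((_ : bool)%:R); apply/idP/idP; rewrite !inE => //=.
    by case.
  have bA : bounded_measurable (\1_A : T2 -> R) by exact: bounded_measurable_indic.
  rewrite Q'E -(@EFin_Rintegral_indic _ _ _ Q) -?(@EFin_Rintegral_indic _ _ _ nu)//;
    last by apply: mpre; exact: measurableX.
  rewrite -(glued_snd hQ bA); congr EFin; apply: eq_Rintegral => w _.
  rewrite !indicE; congr ((_ : bool)%:R); apply/idP/idP; rewrite !inE => //=.
  by case.
have lawQ (h : T1 * T2 -> R) : bounded_measurable h ->
    \int[Q]_w h (X w) = \int[Q']_z h z.
  by move=> bh; apply: Rintegral_law => // A _; rewrite Q'E.
have Q'm : Q' `<< (rho \x nu)%E.
  apply/null_content_dominatesP => A mA mA0; rewrite Q'E.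
  have /null_content_dominatesP Qd := has_density_dominates hQ.
  by apply: Qd; [exact: mpre|exact: etrans (glued_law mA) mA0].
have [g hg] := density_of_dominated Q'm; have [mg g0 gE] := hg.
set lk := fun w => ln (K n.+1 (Y w)).
have lkE w : lk w = - V n.+1 (Y w) by rewrite /lk full_step_densityE expRK.
have blk : bounded_measurable lk.
  have -> : lk = fun w => - V n.+1 (Y w) by apply/funext.
  by apply: bounded_measurableN; exact: (bounded_measurable_comp mY (bV n)).
have blk1 : bounded_measurable (fun w => lk w - 1).
  apply: bounded_measurableD => //; exact: bounded_measurable_cst.
pose r w := g (X w) / K n.+1 (Y w).
have r0 w : 0 <= r w by rewrite divr_ge0// ltW// full_step_density_gt0.
have mr : measurable_fun setT r.
  apply: measurable_funM; first exact: measurableT_comp.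
  have -> : (fun w => (K n.+1 (Y w))^-1) = (fun w => expR (V n.+1 (Y w))).
    by apply/funext => w; rewrite full_step_densityE expRN invrK.
  apply: measurableT_comp => //; apply: measurableT_comp => //.
  exact: (bV n).1.
have r1 : (\int[Q]_w (r w)%:E = 1)%E.
  rewrite (integral_density hQ); last exact/measurable_EFinP.
  under eq_integral => w _.
    rewrite -EFinM divfK ?gt_eqF ?full_step_density_gt0//; over.
  rewrite /= (integral_law (h := EFin \o g) mX _ glued_law); last exact/measurable_EFinP.
  by rewrite -gE//; exact: probability_setT.
have ir : Q.-integrable setT (EFin \o r).
  apply/integrableP; split; first exact/measurable_EFinP.
  under eq_integral do rewrite /= ger0_norm//.
  by rewrite r1 ltry.
have HQ' : (entropy Q' (rho \x nu)%E <= (\int[Q]_w lk w)%:E)%E.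
  rewrite (entropy_density hg (has_density_unit _))//.
  under eq_integral do rewrite divr1.
  have mlg := measurable_lne_EFin mg.
  rewrite -(integral_law (h := fun z => lne (g z)%:E) mX mlg (fun A _ => esym (Q'E A))).
  apply: (@le_trans _ _ (\int[Q]_w ((lk w - 1)%:E + (r w)%:E))%E).
    apply: le_integral_measurable.
    - by apply: (measurable_lne_EFin (f := g \o X)); exact: measurableT_comp.
    - apply: emeasurable_funD; apply/measurable_EFinP => //.
      exact: blk1.1.
    - by move=> w; rewrite -EFinD; apply: lne_le_tangent => //; exact: full_step_density_gt0.
  have iblk1 := bounded_measurable_integrable Q blk1.
  rewrite integralD// r1 -EFin_Rintegral// -EFinD lee_fin.
  rewrite bounded_RintegralB ?Rintegral_cst1//; last exact: bounded_measurable_cst.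
  by rewrite subrK.
have [Cg /(_ _ CQ')] := hgamma; rewrite /eot_cost Hf.
have bci p := bounded_measurable_integrable p bc.
rewrite -!EFin_Rintegral//.
set L0 := fine _.
have L0E : (L0%:E = \int[gamma]_z lne (f z)%:E)%E.
  by rewrite fineK//; exact: integrable_fin_num.
rewrite -L0E => /le_trans /(_ (leeD2l _ (lee_wpmul2l _ HQ'))).
rewrite lee_fin (ltW eps0) => /(_ isT); rewrite -!EFinM -!EFinD lee_fin => opt.
(* The integral of phi + psi is the same for all couplings, so minimality of
   gamma for c carries over to the potential c + phi + psi. *)
have VE (p : probability (T1 * T2)%type R) : coupling rho nu p ->
    \int[p]_z V n.+1 z = eps^-1 * (\int[p]_z c z.1 z.2)
      + eps^-1 * (\int[rho]_x phi n.+1 x + \int[nu]_y psi n.+1 y).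
  move=> Cp.
  have bphi := iter_phi_bounded nu eps0 bc hphi0 n.
  have bpsi := iter_psi_bounded nu eps0 bc hphi0 n.+1.
  have bphi1 : bounded_measurable (fun z : T1 * T2 => phi n.+1 z.1).
    exact: (bounded_measurable_comp _ bphi).
  have bpsi2 : bounded_measurable (fun z : T1 * T2 => psi n.+1 z.2).
    exact: (bounded_measurable_comp _ bpsi).
  rewrite -(coupling_Rintegral_fst Cp bphi) -(coupling_Rintegral_snd Cp bpsi).
  have bcp := bounded_measurableD bc bphi1.
  rewrite -mulrDr addrA -!bounded_RintegralD// -bounded_RintegralZl; last first.
    exact: bounded_measurableD.
  by apply: eq_Rintegral => z _; rewrite mulrC.
have dE : \int[Q']_z V n.+1 z + \int[Q]_w lk w =
    \int[alpha]_v (\int[rho]_x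
     ((V n.+1 (x, v.2) - V n.+1 (x, v.1)) * K n.+1 (x, v.1))).
  have bVX : bounded_measurable (fun w => V n.+1 (X w)).
    exact: (bounded_measurable_comp mX (bV n)).
  have bVd := bounded_measurableD bVX blk.
  rewrite -(lawQ _ (bV n)) -(bounded_RintegralD Q bVX blk).
  rewrite (Rintegral_density hQ bVd).
  rewrite Rintegral_prod21; last exact: bounded_measurableM.
  by apply: eq_Rintegral => v _; apply: eq_Rintegral => x _ /=; rewrite lkE.
rewrite -dE (VE _ Cg) (VE _ CQ').
have : eps^-1 * (\int[gamma]_z c z.1 z.2 + eps * L0) <=
    eps^-1 * (\int[Q']_z c z.1 z.2 + eps * \int[Q]_w lk w).
  by rewrite ler_pM2l// invr_gt0.
rewrite !mulrDr !mulKf ?gt_eqF//; lra.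
Qed.

End stability.

(** * Contraction of the entropy *)

(** With e = eps and l = L2: H stands for H n.+2, A for H(nu^{n+1} | nu), and r - s
    for H n.+1 - H n.+2. *)
Lemma contraction_factor (R : realType) (e t l H A r s : R) :
  0 < e -> 0 < t -> 0 < l -> 2 * e ^+ 2 / l * H <= 2 * t * A -> A <= r ->
  s <= 0 -> H <= (1 - e ^+ 2 / (e ^+ 2 + t * l)) * (H + (r - s)).
Proof.
move=> e0 t0 l0 hA Ar s0.
have e20 : 0 < e ^+ 2 by rewrite exprn_gt0.
have tl0 : 0 < t * l by rewrite mulr_gt0.
have hA' : e ^+ 2 * H <= t * l * A.
  by move: hA; rewrite mulrAC ler_pdivrMr//; lra.
have den : 0 < e ^+ 2 + t * l by rewrite addr_gt0.
have -> : 1 - e ^+ 2 / (e ^+ 2 + t * l) = (t * l) / (e ^+ 2 + t * l).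
  by field; rewrite gt_eqF.
rewrite mulrAC ler_pdivlMr//.
have : t * l * A <= t * l * (r - s) by rewrite ler_pM2l//; lra.
lra.
Qed.

Lemma log_tangents_le (R : realType) (u v w : R) :
  w + (2 - (expR (- u) + expR v)) <= w + u - v.
Proof. by have := expR_ge1Dx (- u); have := expR_ge1Dx v; lra. Qed.

Section contraction.
Context (d1 d2 : measure_display) (T1 : measurableType d1)
  (T2 : measurableType d2) (R : realType).
Variables (rho : probability T1 R) (nu : probability T2 R)
  (c : T1 -> T2 -> R) (eps : R) (phi0 : T1 -> R).
Hypotheses (eps0 : 0 < eps) (bc : bounded_measurable (fun z => c z.1 z.2))
  (hphi0 : sinkhorn_init eps rho phi0).
Variables (gamma : probability (T1 * T2)%type R)
  (plan : nat -> probability (T1 * T2)%type R).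
Hypotheses (hgamma : eot_plan c eps rho nu gamma)
  (hplan : sinkhorn_plans c eps rho nu phi0 plan).

Local Notation K n := (full_step_density rho nu c eps phi0 n).
Local Notation V n := (potential rho nu c eps phi0 n).
Local Notation a n := (logratio_rho rho nu c eps phi0 n).
Local Notation b n := (logratio_nu rho nu c eps phi0 n).

Let bV n : bounded_measurable (V n.+1) := potential_bounded nu eps0 bc hphi0 n.
Let ba n : bounded_measurable (a n.+1) := logratio_rho_bounded nu eps0 bc hphi0 n.
Let bb n : bounded_measurable (b n) := logratio_nu_bounded nu eps0 bc hphi0 n.
Let Cg : coupling rho nu gamma := hgamma.1.

Lemma plan_density n : has_density (rho \x nu)%E (K n) (plan n).
Proof.
split; first exact: (measurable_full_step_density nu eps0 bc hphi0).
- by move=> z; rewrite ltW// full_step_density_gt0.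
- exact: hplan.
Qed.

Lemma entropy_planE n f : has_density (rho \x nu)%E f gamma ->
  entropy gamma (plan n) = (\int[gamma]_z (lne (f z)%:E + (V n z)%:E))%E.
Proof.
move=> hf; rewrite (entropy_density hf (plan_density n)); last exact: full_step_density_gt0.
apply: eq_integral => z _; rewrite full_step_densityE; apply: lne_divr.
by have [] := hf.
Qed.

Let mass1 (g : T1 * T2 -> R) : measurable_fun setT g -> (forall z, 0 <= g z) ->
  (\int[gamma]_z (g z)%:E = 1)%E ->
  gamma.-integrable setT (EFin \o g) /\ \int[gamma]_z g z = 1.
Proof.
move=> mg g0 g1; split; last by rewrite /Rintegral g1.
apply/integrableP; split; first exact/measurable_EFinP.
under eq_integral do rewrite /= ger0_norm//.
by rewrite g1 ltry.
Qed.

(** The integrand of H n minus that of H n.+1 is a(x) - b(y), where exp (-a) and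
    exp b have integral 1. Bounding a below by 1 - exp (-a) and -b by 1 - exp b
    keeps the argument valid when phi0 is not integrable and H 0 may be
    infinite. *)
Lemma entropy_plan_le n : (entropy gamma (plan n.+1) <= entropy gamma (plan n))%E.
Proof.
have [f [hf If Hf]] := entropy_lty_density (eot_plan_entropy_lty eps0 bc hgamma).
rewrite !(entropy_planE _ hf).
have [mf f0 _] := hf; have ml := measurable_lne_EFin mf.
have ma := measurable_logratio_rho nu eps0 bc hphi0 n.
pose g1 := fun z : T1 * T2 => expR (- a n z.1).
pose g2 := fun z : T1 * T2 => expR (b n z.2).
have me1 : measurable_fun setT (fun x => expR (- a n x)).
  by apply: measurableT_comp => //; exact: measurable_funN.
have be2 := bounded_measurable_expR (bb n).
have [i1 I1] : gamma.-integrable setT (EFin \o g1) /\ \int[gamma]_z g1 z = 1.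
  apply: mass1; first exact: (measurableT_comp me1 measurable_fst).
    by move=> z; exact: expR_ge0.
  rewrite -(logratio_rho_mass nu eps0 bc hphi0 n).
  apply: (integral_law (X := fst) (h := fun x => (expR (- a n x))%:E)) => //.
    exact/measurable_EFinP.
  exact: (coupling_fst Cg).
have [i2 I2] : gamma.-integrable setT (EFin \o g2) /\ \int[gamma]_z g2 z = 1.
  have bg2 : bounded_measurable g2 by exact: (bounded_measurable_comp _ be2).
  split; first exact: bounded_measurable_integrable.
  by rewrite (coupling_Rintegral_snd Cg be2) (logratio_nu_mass nu eps0 bc hphi0).
pose e z := 2 - (g1 z + g2 z).
have i12 : gamma.-integrable setT (EFin \o (fun z => g1 z + g2 z)).
  exact: (integrableD measurableT i1 i2).
have ic : gamma.-integrable setT (EFin \o (fun=> 2)).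
  exact/bounded_measurable_integrable/bounded_measurable_cst.
have ie : gamma.-integrable setT (EFin \o e).
  exact: (integrableB measurableT ic i12).
have e0 : (\int[gamma]_z (e z)%:E = 0)%E.
  rewrite -EFin_Rintegral// RintegralB// RintegralD// I1 I2 Rintegral_cst1.
  by rewrite subrr.
have iV : gamma.-integrable setT (EFin \o V n.+1).
  exact: bounded_measurable_integrable.
have iF := integrableD measurableT If iV.
rewrite -[leLHS]adde0 -e0 -integralD//.
apply: le_integral_measurable.
- by apply: measurable_int (integrableD measurableT iF ie).
- apply: emeasurable_funD => //; apply/measurable_EFinP.
  exact: (measurable_potential nu eps0 bc hphi0).
- move=> z; rewrite -addeA; apply: leeD2l; rewrite -EFinD lee_fin.
  rewrite (potentialB rho nu c phi0 eps0 n z) /e /g1 /g2.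
  exact: log_tangents_le.
Qed.

Variables (D2 : T2 -> T2 -> R) (L2 tau : R).
Hypotheses (L20 : 0 < L2) (tau0 : 0 < tau)
  (D20 : forall y y', 0 <= D2 y y')
  (bD2 : bounded_measurable (fun v => D2 v.1 v.2))
  (cD2 : forall x y y', (c x y - c x y') ^+ 2 <= L2 * D2 y' y)
  (TI : forall mu : probability T2 R,
    (ereal_inf [set (\int[al]_z (D2 z.1 z.2)%:E)%E | al in coupling mu nu]
      <= (2 * tau)%:E * entropy mu nu)%E).

Let rate := 1 - eps ^+ 2 / (eps ^+ 2 + tau * L2).

Lemma entropy_plan_contract n :
  (entropy gamma (plan n.+2) <= rate%:E * entropy gamma (plan n.+1))%E.
Proof.
have [f [hf If Hf]] := entropy_lty_density (eot_plan_entropy_lty eps0 bc hgamma).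
set L0 := fine (\int[gamma]_z lne (f z)%:E)%E.
have HE m : entropy gamma (plan m.+1) = (L0 + \int[gamma]_z V m.+1 z)%:E.
  have iV : gamma.-integrable setT (EFin \o V m.+1).
    exact: bounded_measurable_integrable.
  rewrite (entropy_planE _ hf) (integralD measurableT If iV).
  by rewrite EFinD (EFin_Rintegral iV) fineK//; exact: integrable_fin_num If.
pose eb y := expR (b n.+1 y).
have beb : bounded_measurable eb := bounded_measurable_expR (bb n.+1).
have [nun hnun] : exists nun, has_density nu eb nun.
  apply: exists_density; [exact: beb.1|by move=> y; exact: expR_ge0|].
  rewrite -EFin_Rintegral ?(logratio_nu_mass nu eps0 bc hphi0)//.
  exact: bounded_measurable_integrable.
set Anu := \int[nu]_y (b n.+1 y * eb y).
have Hnun : entropy nun nu = Anu%:E.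
  rewrite (entropy_density hnun (has_density_unit nu))// /Anu.
  rewrite -(Rintegral_density hnun (bb n.+1)) EFin_Rintegral; last first.
    exact: bounded_measurable_integrable.
  apply: eq_integral => y _.
  by rewrite divr1 lne_EFin ?expR_gt0// expRK.
set h := L0 + \int[gamma]_z V n.+2 z.
have hW : ((2 * eps ^+ 2 / L2 * h)%:E <=
    ereal_inf [set (\int[al]_z (D2 z.1 z.2)%:E)%E | al in coupling nun nu])%E.
  apply: le_ereal_inf_tmp => _ [al Cal <-].
  rewrite -EFin_Rintegral; last first.
    exact: (@bounded_measurable_integrable _ _ _ al _ bD2).
  have := stability eps0 bc hphi0 hgamma hnun Cal hf If Hf.
  rewrite -/L0 -/h lee_fin => hle.
  pose F (z : T1 * (T2 * T2)) : R :=
    (V n.+2 (z.1, z.2.2) - V n.+2 (z.1, z.2.1)) * K n.+2 (z.1, z.2.1).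
  have bF : bounded_measurable F.
    have mX : measurable_fun setT (fun w : T1 * (T2 * T2) => (w.1, w.2.2)).
      by apply: measurable_fun_pair => //; exact: measurableT_comp.
    have mY : measurable_fun setT (fun w : T1 * (T2 * T2) => (w.1, w.2.1)).
      by apply: measurable_fun_pair => //; exact: measurableT_comp.
    apply: bounded_measurableM.
      apply: bounded_measurableD; first exact: (bounded_measurable_comp mX (bV n.+1)).
      by apply: bounded_measurableN; exact: (bounded_measurable_comp mY (bV n.+1)).
    exact: (bounded_measurable_comp mY (full_step_density_bounded nu eps0 bc hphi0 n.+1)).
  have bI := bounded_measurable_Rintegral (F := F) rho bF.
  have bW : bounded_measurable (fun v => L2 / (2 * eps ^+ 2) * D2 v.1 v.2).
    by apply: bounded_measurableM => //; exact: bounded_measurable_cst.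
  have := le_trans hle (bounded_le_Rintegral al bI bW _).
  rewrite (bounded_RintegralZl al _ bD2).
  have -> : 2 * eps ^+ 2 / L2 * h = (L2 / (2 * eps ^+ 2))^-1 * h.
    by rewrite invf_div.
  rewrite ler_pdivrMl ?divr_gt0 ?mulr_gt0 ?exprn_gt0//; apply => v.
  have B0 := sqrtr_ge0 (L2 * D2 v.1 v.2).
  have := conditional_entropy_le nu eps0 bc hphi0 n.+1 (y := v.2) (y' := v.1) B0.
  move=> /(_ _)/le_trans; apply.
    by move=> x; rewrite -sqrtr_sqr ler_wsqrtr.
  rewrite expr_div_n sqr_sqrtr ?mulr_ge0 ?(ltW L20)//.
  by rewrite le_eqVlt; apply/orP; left; apply/eqP; field; rewrite gt_eqF.
have := le_trans hW (TI nun); rewrite Hnun -EFinM lee_fin => hA.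
have AA : Anu <= \int[rho]_x a n.+1 x := marginal_entropy_le nu eps0 bc hphi0 n.
have b0 := logratio_nu_le0 nu eps0 bc hphi0 n.+1.
have step : \int[gamma]_z V n.+1 z = \int[gamma]_z V n.+2 z +
    \int[rho]_x a n.+1 x - \int[nu]_y b n.+1 y.
  have ba1 : bounded_measurable (fun z : T1 * T2 => a n.+1 z.1).
    exact: (bounded_measurable_comp _ (ba n)).
  have bb2 : bounded_measurable (fun z : T1 * T2 => b n.+1 z.2).
    exact: (bounded_measurable_comp _ (bb n.+1)).
  rewrite -(coupling_Rintegral_fst Cg (ba n)) -(coupling_Rintegral_snd Cg (bb n.+1)).
  rewrite -(bounded_RintegralD gamma (bV n.+1) ba1).
  rewrite -(bounded_RintegralB gamma (bounded_measurableD (bV n.+1) ba1) bb2).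
  by apply: eq_Rintegral => z _; exact: potentialB.
have E2 : entropy gamma (plan n.+1) =
    (h + (\int[rho]_x a n.+1 x - \int[nu]_y b n.+1 y))%:E.
  by rewrite (HE n) step; congr EFin; rewrite /h !addrA.
have E1 : entropy gamma (plan n.+2) = h%:E := HE n.+1.
rewrite E1 E2 -EFinM lee_fin.
exact: contraction_factor hA AA b0.
Qed.

End contraction.

(** The contraction for an arbitrary bounded cost on measurable spaces, where D2
    plays the role of the squared distance in the transport inequality and L2 is
    the squared Lipschitz constant of the cost in its second argument. *)
Lemma sinkhorn_rate_of_transport (d1 d2 : measure_display)
    (T1 : measurableType d1) (T2 : measurableType d2) (R : realType)
    (rho : probability T1 R) (nu : probability T2 R) (c : T1 -> T2 -> R)
    (eps : R) (phi0 : T1 -> R) (D2 : T2 -> T2 -> R) (L2 tau : R) :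
  0 < eps -> bounded_measurable (fun z => c z.1 z.2) ->
  sinkhorn_init eps rho phi0 -> 0 < L2 -> 0 < tau ->
  (forall y y', 0 <= D2 y y') -> bounded_measurable (fun v => D2 v.1 v.2) ->
  (forall x y y', (c x y - c x y') ^+ 2 <= L2 * D2 y' y) ->
  (forall mu : probability T2 R,
    (ereal_inf [set (\int[al]_z (D2 z.1 z.2)%:E)%E | al in coupling mu nu]
      <= (2 * tau)%:E * entropy mu nu)%E) ->
  sinkhorn_rate c eps rho nu phi0 (1 - eps ^+ 2 / (eps ^+ 2 + tau * L2)).
Proof.
move=> eps0 bc hphi0 L20 tau0 D20 bD2 cD2 TI gamma plan hgamma hplan n _.
set r := 1 - _.
have r0 : 0 <= r.
  have e20 : 0 < eps ^+ 2 by rewrite exprn_gt0.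
  have tL0 : 0 < tau * L2 by rewrite mulr_gt0.
  by rewrite subr_ge0 ler_pdivrMr ?addr_gt0// mul1r lerDl ltW.
elim: n => [|n ih].
  by rewrite expr0 mul1e; exact: (entropy_plan_le eps0 bc hphi0 hgamma hplan).
have := entropy_plan_contract eps0 bc hphi0 hgamma hplan L20 tau0 D20 bD2 cD2 TI n.
move=> /le_trans; apply; rewrite (exprS r n) EFinM -muleA.
by apply: lee_wpmul2l.
Qed.

(** * The sphere *)

Section dotp.
Context {R : realType} {n : nat}.
Implicit Types x y z : 'rV[R]_n.

Lemma dotpC x y : dotp x y = dotp y x.
Proof. by apply: eq_bigr => i _; rewrite mulrC. Qed.

Lemma dotpBr x y z : dotp x (y - z) = dotp x y - dotp x z.
Proof. by rewrite /dotp -sumrB; apply: eq_bigr => i _; rewrite !mxE mulrBr. Qed.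

Lemma dotpZr (t : R) x y : dotp x (t *: y) = t * dotp x y.
Proof. by rewrite /dotp mulr_sumr; apply: eq_bigr => i _; rewrite !mxE mulrCA. Qed.

Lemma dotp_ge0 x : 0 <= dotp x x.
Proof. by apply: sumr_ge0 => i _; rewrite -expr2 sqr_ge0. Qed.

(** The squared norm of the component of z orthogonal to x is nonnegative. *)
Lemma cauchy_schwarz_unit x z : dotp x x = 1 -> dotp x z ^+ 2 <= dotp z z.
Proof.
move=> x1; have := dotp_ge0 (z - dotp x z *: x).
rewrite dotpBr dotpZr ![dotp (_ - _) _]dotpC !dotpBr !dotpZr x1 (dotpC z x).
lra.
Qed.

End dotp.

Section sphere_geometry.
Context {R : realType} {d : nat}.
Implicit Types x y : sphere R d.

Lemma sphere_unit x : dotp (set_val x) (set_val x) = 1.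
Proof. exact: (set_mem (svalP x)). Qed.

Lemma sdot_norm_le1 x y : `|sdot x y| <= 1.
Proof.
rewrite -[leRHS]sqrtr1 -sqrtr_sqr ler_wsqrtr//.
by rewrite -(sphere_unit y); apply: cauchy_schwarz_unit; exact: sphere_unit.
Qed.

Lemma sdot_bounds x y : -1 <= sdot x y <= 1.
Proof. by rewrite -ler_norml sdot_norm_le1. Qed.

Lemma sdot_lipschitz x y y' :
  (sdot x y - sdot x y') ^+ 2 <= sdist y' y ^+ 2.
Proof.
apply: le_trans (acos_sq_ge (sdot_bounds y' y)).
rewrite /sdot -dotpBr; apply: le_trans (cauchy_schwarz_unit _ (sphere_unit x)) _.
rewrite !dotpBr ![dotp (_ - _) _]dotpC !dotpBr !sphere_unit.
by rewrite (dotpC (set_val y) (set_val y')); lra.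
Qed.

Lemma measurable_coord (i : 'I_d.+1) :
  measurable_fun setT (fun x : sphere R d => set_val x ord0 i).
Proof.
have cf : continuous (fun x : sphere R d => set_val x ord0 i).
  move=> x; apply: (@continuous_comp _ _ _ set_val (fun M : 'rV[R]_d.+1 => M ord0 i)).
    exact: (@initial_continuous (sphere R d) _ set_val).
  exact: coord_continuous.
apply: (measurability _ (RGenOpens.measurableE R)).
move=> _ [_ [a [b ->] <-]]; rewrite setTI; apply: sub_sigma_algebra.
by move/continuousP : cf; apply; exact: interval_open.
Qed.

Lemma measurable_sdot :
  measurable_fun setT (fun z : sphere R d * sphere R d => sdot z.1 z.2).
Proof.
apply: measurable_sum => i; apply: measurable_funM.
  exact: (measurableT_comp (measurable_coord i) measurable_fst).
exact: (measurableT_comp (measurable_coord i) measurable_snd).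
Qed.

Let clamp (t : R) : R := Num.max (-1) (Num.min t 1).

Let clamp_bounds t : -1 <= clamp t <= 1.
Proof. by rewrite /clamp le_max lexx /= ge_max ge_min lexx orbT andbT; lra. Qed.

(** The clamped acos is nonincreasing on the whole line, hence measurable. *)
Lemma measurable_acos_comp (d' : measure_display) (T : measurableType d')
    (f : T -> R) : measurable_fun setT f -> (forall t, -1 <= f t <= 1) ->
  measurable_fun setT (fun t => acos (f t)).
Proof.
move=> mf f1.
have -> : (fun t => acos (f t)) = (acos \o clamp) \o f.
  apply/funext => t; have /andP[a b] := f1 t.
  by rewrite /= /clamp min_l// max_r.
apply: measurableT_comp => //; apply: nonincreasing_measurable => // s t st /=.
have /acos_def[/andP[s0 spi] sE] := clamp_bounds s.
have /acos_def[/andP[t0 tpi] tE] := clamp_bounds t.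
rewrite leNgt -ltr_cos ?in_itv/= ?s0 ?t0// sE tE -leNgt.
by rewrite /clamp ge_max !le_max lexx/= le_min !ge_min st lexx !orbT.
Qed.

Lemma cost_dot_bounded :
  bounded_measurable (fun z : sphere R d * sphere R d => cost_dot z.1 z.2).
Proof.
split; first by apply: measurable_funB => //; exact: measurable_sdot.
exists 2 => z; rewrite (le_trans (ler_normB _ _))// normr1.
by have := sdot_norm_le1 z.1 z.2; lra.
Qed.

Lemma acos_sq_bounded (f : sphere R d * sphere R d -> R) :
  measurable_fun setT f -> (forall t, -1 <= f t <= 1) ->
  bounded_measurable (fun z => acos (f z) ^+ 2).
Proof.
move=> mf f1; split; first by apply: measurable_funX; exact: measurable_acos_comp.
exists (pi ^+ 2) => z; rewrite ger0_norm ?sqr_ge0//.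
by have /acos_def[/andP[a0 api] _] := f1 z; rewrite ler_pXn2r ?nnegrE// pi_ge0.
Qed.

Lemma sdist_sq_bounded :
  bounded_measurable (fun z : sphere R d * sphere R d => sdist z.1 z.2 ^+ 2).
Proof.
apply: (acos_sq_bounded measurable_sdot) => z; exact: sdot_bounds.
Qed.

Let scale_norm (delta : R) x y : 0 <= delta -> `|delta * sdot x y| <= delta.
Proof.
move=> d0; rewrite normrM (ger0_norm d0) -[leRHS]mulr1.
by rewrite ler_wpM2l// sdot_norm_le1.
Qed.

Let scale_bounds (delta : R) x y : 0 < delta < 1 -> -1 <= delta * sdot x y <= 1.
Proof.
move=> /andP[d0 d1]; rewrite -ler_norml (le_trans (scale_norm _ _ (ltW d0)))//.
exact: ltW.
Qed.

Lemma cost_acos_bounded (delta : R) : 0 < delta < 1 ->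
  bounded_measurable
    (fun z : sphere R d * sphere R d => cost_acos delta z.1 z.2).
Proof.
move=> hd; apply: (@acos_sq_bounded (fun z => delta * sdot z.1 z.2)).
  by apply: measurable_funM => //; exact: measurable_sdot.
by move=> z; exact: scale_bounds.
Qed.

(** The difference of squares factors into a sum, at most 2 pi, and a difference of
    two values of acos, which is Lipschitz on [-delta, delta]. *)
Lemma cost_acos_lipschitz (delta : R) x y y' : 0 < delta < 1 ->
  (cost_acos delta x y - cost_acos delta x y') ^+ 2
    <= 4 * pi ^+ 2 / (1 - delta ^+ 2) * sdist y' y ^+ 2.
Proof.
move=> hd; have /andP[d0 d1] := hd.
have d2 : 0 < 1 - delta ^+ 2 by nra.
have /acos_def[/andP[s0 spi] _] := scale_bounds x y hd.
have /acos_def[/andP[t0 tpi] _] := scale_bounds x y' hd.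
have hd' : 0 <= delta < 1 by rewrite (ltW d0).
have := acos_lipschitz hd' (scale_norm x y (ltW d0)) (scale_norm x y' (ltW d0)).
have := sdot_lipschitz x y y'.
rewrite /cost_acos; move: (sdist y' y) => th.
set A := acos _ in s0 spi *; set B := acos _ in t0 tpi *.
rewrite -mulrBr normrM (gtr0_norm d0) => st AB.
have AB2 : (A - B) ^+ 2 <= th ^+ 2 / (1 - delta ^+ 2).
  rewrite -[(A - B) ^+ 2]real_normK ?num_real//.
  have := AB; rewrite -(@ler_pXn2r _ 2)// ?nnegrE;
    try by rewrite ?divr_ge0 ?mulr_ge0 ?sqrtr_ge0 ?(ltW d0).
  rewrite expr_div_n sqr_sqrtr ?(ltW d2)// => /le_trans; apply.
  rewrite ler_pM2r ?invr_gt0// exprMn real_normK ?num_real//.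
  apply: le_trans st; rewrite -[leRHS]mul1r ler_wpM2r ?sqr_ge0//.
  by rewrite expr_le1// ltW.
rewrite subr_sqr exprMn.
have -> : 4 * pi ^+ 2 / (1 - delta ^+ 2) * th ^+ 2 =
  th ^+ 2 / (1 - delta ^+ 2) * (2 * pi) ^+ 2 by field; rewrite gt_eqF.
apply: ler_pM; rewrite ?sqr_ge0// ler_pXn2r ?nnegrE ?addr_ge0 ?mulr_ge0 ?pi_ge0//.
lra.
Qed.

End sphere_geometry.

Lemma sphere_sinkhorn_rate (R : realType) (d : nat)
    (rho nu : probability (sphere R d) R) (tau eps L2 : R)
    (c : sphere R d -> sphere R d -> R) (phi0 : sphere R d -> R) :
  0 < tau -> transport_inequality nu tau -> 0 < eps -> 0 < L2 ->
  bounded_measurable (fun z => c z.1 z.2) ->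
  (forall x y y', (c x y - c x y') ^+ 2 <= L2 * sdist y' y ^+ 2) ->
  sinkhorn_init eps rho phi0 ->
  sinkhorn_exp_cvg c eps rho nu phi0 /\
  sinkhorn_rate c eps rho nu phi0 (1 - eps ^+ 2 / (eps ^+ 2 + tau * L2)).
Proof.
move=> tau0 TI eps0 L20 bc cL hphi0.
have rate := sinkhorn_rate_of_transport eps0 bc hphi0 L20 tau0
  (fun y y' => sqr_ge0 (sdist y y')) sdist_sq_bounded cL TI.
split => //; exists (eps ^+ 2 / (eps ^+ 2 + tau * L2)); split => //.
have e20 : 0 < eps ^+ 2 by rewrite exprn_gt0.
have tL0 : 0 < tau * L2 by rewrite mulr_gt0.
by rewrite divr_gt0 ?addr_gt0//= ltr_pdivrMr ?addr_gt0// mul1r ltrDl.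
Qed.

Theorem mainTheorem9 (R : realType) (d : nat) (hd : (0 < d)%N)
    (rho nu : probability (sphere R d) R) (tau : R) (htau : 0 < tau)
    (hTI : transport_inequality nu tau) :
  (forall (eps : R) (phi0 : sphere R d -> R),
     0 < eps -> sinkhorn_init eps rho phi0 ->
     sinkhorn_exp_cvg (@cost_dot R d) eps rho nu phi0 /\
     (eps <= tau + Num.sqrt (tau + tau ^+ 2) ->
      sinkhorn_rate (@cost_dot R d) eps rho nu phi0
        (1 - eps ^+ 2 / (eps ^+ 2 + 2 * tau * eps + tau))))
  /\
  (forall (delta eps : R) (phi0 : sphere R d -> R),
     0 < delta < 1 -> 0 < eps -> sinkhorn_init eps rho phi0 ->
     sinkhorn_exp_cvg (@cost_acos R d delta) eps rho nu phi0 /\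
     (eps <= tau * (delta ^+ 2 + 2 * pi / Num.sqrt (1 - delta ^+ 2))
             + Num.sqrt (tau ^+ 2
                 * (delta ^+ 2 + 2 * pi / Num.sqrt (1 - delta ^+ 2)) ^+ 2
                 + 4 * pi ^+ 2 * tau / (1 - delta ^+ 2)) ->
      sinkhorn_rate (@cost_acos R d delta) eps rho nu phi0
        (1 - eps ^+ 2
             / (eps ^+ 2
                + 2 * tau * eps
                  * (delta ^+ 2 + 2 * pi / Num.sqrt (1 - delta ^+ 2))
                + 4 * pi ^+ 2 * tau / (1 - delta ^+ 2))))).
Proof.
split=> [eps phi0 eps0 hphi0|delta eps phi0 hdelta eps0 hphi0].
  have L20 : 0 < 2 * eps + 1 by lra.
  have [] := sphere_sinkhorn_rate htau hTI eps0 L20 cost_dot_bounded _ hphi0.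
    move=> x y y'; have -> : cost_dot x y - cost_dot x y' = - (sdot x y - sdot x y').
      by rewrite /cost_dot; ring.
    rewrite sqrrN; apply: le_trans (sdot_lipschitz x y y') _.
    by rewrite -[leLHS]mul1r ler_wpM2r ?sqr_ge0//; lra.
  move=> exp rate; split => // _.
  by move: rate; congr (sinkhorn_rate _ _ _ _ _ (1 - _ / _)); ring.
have /andP[d0 d1] := hdelta.
have d2 : 0 < 1 - delta ^+ 2 by nra.
set M := delta ^+ 2 + _.
have M0 : 0 <= M.
  by rewrite addr_ge0 ?sqr_ge0// divr_ge0 ?sqrtr_ge0// mulr_ge0 ?pi_ge0.
have P0 : 0 < 4 * pi ^+ 2 / (1 - delta ^+ 2) :> R.
  by rewrite divr_gt0// mulr_gt0// exprn_gt0// pi_gt0.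
have e0 : 0 <= 2 * eps * M by rewrite !mulr_ge0// ltW.
have L20 : 0 < 2 * eps * M + 4 * pi ^+ 2 / (1 - delta ^+ 2) by rewrite ltr_wpDl.
have [] := sphere_sinkhorn_rate htau hTI eps0 L20 (cost_acos_bounded hdelta) _ hphi0.
  move=> x y y'; apply: le_trans (cost_acos_lipschitz x y y' hdelta) _.
  by rewrite ler_wpM2r ?sqr_ge0// lerDr.
move=> exp rate; split => // _.
by move: rate; congr (sinkhorn_rate _ _ _ _ _ (1 - _ / _)); field; rewrite gt_eqF.
Qed.
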